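(* Let $\beta\in(\frac{\pi}{2},\pi)$ and $\theta_c=\pi$. In a neighborhood of the point $(A,\sigma)=(1,0)$ in $\Omega_0$, the set of steady states for $(\beta,\pi)$ is parametrized by a continuous function $\sigma=\sigma(A;\beta,\theta_c=\pi)$, in the following sense. There exist $\epsilon\in(0,1)$ and a continuous function $A\mapsto\sigma(A;\beta,\pi)$ on $(1-\epsilon,1)$ with $(A,\sigma(A;\beta,\pi))\in\Omega_0$ such that the map assigning to a steady state the pair $(A,\sigma)$, where $A=r_3^*$ and $\sigma$ is the arclength of $\Gamma_3$, is a bijection from the set of steady states for $(\beta,\pi)$ with $1-\epsilon<A<1$ onto the graph $\{(A,\sigma(A;\beta,\pi)) : 1-\epsilon<A<1\}$. Furthermore, for every $A\in(1-\epsilon,1)$ the triple $(A,\sigma,\beta)$ with $\sigma=\sigma(A;\beta,\pi)$ satisfies the four constraints $$\tan\beta>\tfrac{A}{\sigma}(1-2A^2-2\sigma^2),$$ $$\cos\beta<-\tfrac{1}{2A}\quad\text{if}\quad \cos\beta<-\tfrac{A}{\sqrt{\sigma^2+A^2}},$$ $$z_1(\pi)\le 0,$$ $$\tan\beta<\frac{A(1-A^2-2\sigma^2)}{\sigma(1-A^2)}.$$ Moreover $\lim_{A\to1^-}\sigma(A;\beta,\pi)=0$.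
   Context: **Steady states.** Fix $\beta\in[\pi/2,\pi)$ and $\theta_c\in[0,\pi]$. A steady state for $(\beta,\theta_c)$ consists of three curves $\Gamma_i=\{(r_i(\alpha),z_i(\alpha)):\alpha\in[0,1]\}$, $i=1,2,3$, with $r_i,z_i\in C^2([0,1])$ (subscript $\alpha$ denotes $d/d\alpha$), such that: (a) $0<r_1,r_3<1$ on $[0,1]$; $0<r_2<1$ on $[0,1)$; $z_1,z_3>0$ on $(0,1]$; $z_2>0$ on $[0,1]$. (b) There are numbers $0<r_1^*<r_3^*<1$, $z_2^*>0$, $\bar r\in(0,1)$, $\bar z>0$ with $(r_1,z_1)(0)=(r_1^*,0)$, $(r_1,z_1)(1)=(\bar r,\bar z)$, $(r_2,z_2)(0)=(\bar r,\bar z)$, $(r_2,z_2)(1)=(1,z_2^* )$, $(r_3,z_3)(0)=(r_3^*,0)$, $(r_3,z_3)(1)=(\bar r,\bar z)$. (c) For each $i$, $r_{i\alpha}^2+z_{i\alpha}^2$ is a positive constant. (d) With $H_i=\frac{r_{i\alpha}z_{i\alpha\alpha}-z_{i\alpha}r_{i\alpha\alpha}}{2(r_{i\alpha}^2+z_{i\alpha}^2)^{3/2}}+\frac{z_{i\alpha}}{2r_i\sqrt{r_{i\alpha}^2+z_{i\alpha}^2}}$, there is $\lambda\in\mathbb R$ with $H_1\equiv H_2\equiv\lambda$ and $H_3\equiv0$ on $[0,1]$. (e) There are continuous $\theta_i:[0,1]\to(-\pi,\pi]$ with $(\cos\theta_i,\sin\theta_i)=(r_{i\alpha},z_{i\alpha})/\sqrt{r_{i\alpha}^2+z_{i\alpha}^2}$,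 and $\theta_1(0)=\theta_c$, $\theta_2(1)=0$, $\theta_3(0)=\pi/2$, $-\theta_1(1)+\theta_3(1)=\beta$, $\theta_2(0)-\theta_3(1)=-\pi+\beta$. (f) No $\Gamma_i$ self-intersects, and any two distinct curves $\Gamma_i,\Gamma_j$ intersect only at $(\bar r,\bar z)$. **Notation.** $\Omega_0=\{(A,\sigma):0<A<1,\ 0<\sigma<\sqrt{1-A^2}\}$. For $(A,\sigma)\in\Omega_0$ and $\beta\in(\pi/2,\pi)$ with $\tan\beta>\frac{A}{\sigma}(1-2A^2-2\sigma^2)$, set $\bar r=\sqrt{\sigma^2+A^2}$, $\bar z=A\,\mathrm{arccosh}(\bar r/A)$, $\bar\theta_3=\arcsin(A/\bar r)$, $\bar\theta_1=\bar\theta_3-\beta$, $\lambda=\frac{A\cos\beta+\sigma\sin\beta}{1-A^2-\sigma^2}$, $a_\ell=\sqrt{\frac{(2A^2+2\sigma^2-1)A\cos\beta+\sigma\sin\beta}{A\cos\beta+\sigma\sin\beta}}$, and $$z_1(\theta)=\bar z-\frac1{2\lambda}\int_{\bar\theta_1}^{\theta}\Big(\frac{\sin^2x}{\sqrt{\sin^2x+4\lambda^2a_\ell^2}}-\sin x\Big)dx .$$ In the constraints, $z_1(\pi)$ is the value of this function at $\theta=\pi$. *)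

(* Defs.v *)
From Stdlib Require Export Reals Lra.
From Coquelicot Require Export Coquelicot.
Open Scope R_scope.

Definition I01 (x : R) : Prop := 0 <= x <= 1.

(** An element of C^2([0,1]), carried together with its first two derivatives.
    [D_in _ _ I01] is the derivative relative to [0,1], hence one-sided at the
    endpoints; the values of [d1] and [d2] on [0,1] are therefore determined by
    those of [fn].  Values outside [0,1] are junk. *)
Record C2fun : Type := mkC2fun {
  fn :> R -> R;
  d1 : R -> R;
  d2 : R -> R;
  d1_spec : forall x, I01 x -> D_in fn d1 I01 x;
  d2_spec : forall x, I01 x -> D_in d1 d2 I01 x;
  d2_cont : forall x, I01 x -> continue_in d2 I01 x
}.

Record curve : Type := mkCurve { cr : C2fun; cz : C2fun }.

Definition at_point (G : curve) (a r z : R) : Prop := cr G a = r /\ cz G a = z.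

Definition speed2 (G : curve) (a : R) : R := d1 (cr G) a ^ 2 + d1 (cz G) a ^ 2.

Definition arclength (G : curve) : R := RInt (fun a => sqrt (speed2 G a)) 0 1.

Definition mean_curv (G : curve) (a : R) : R :=
  (d1 (cr G) a * d2 (cz G) a - d1 (cz G) a * d2 (cr G) a)
    / (2 * Rpower (speed2 G a) (3 / 2))
  + d1 (cz G) a / (2 * cr G a * sqrt (speed2 G a)).

Definition const_speed (G : curve) : Prop :=
  exists c, 0 < c /\ forall a, I01 a -> speed2 G a = c.

Definition is_angle (G : curve) (th : R -> R) : Prop :=
  forall a, I01 a ->
    continue_in th I01 a /\
    - PI < th a <= PI /\
    cos (th a) = d1 (cr G) a / sqrt (speed2 G a) /\
    sin (th a) = d1 (cz G) a / sqrt (speed2 G a).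

Definition simple_curve (G : curve) : Prop :=
  forall a b, I01 a -> I01 b -> cr G a = cr G b -> cz G a = cz G b -> a = b.

Definition meet_only_at (G G' : curve) (r z : R) : Prop :=
  forall a b, I01 a -> I01 b -> cr G a = cr G' b -> cz G a = cz G' b ->
    at_point G a r z.

Record config : Type := mkConfig { Gam1 : curve; Gam2 : curve; Gam3 : curve }.

Definition steady_state (beta thc : R) (S : config) : Prop :=
  let G1 := Gam1 S in let G2 := Gam2 S in let G3 := Gam3 S in
  (forall a, 0 <= a <= 1 -> 0 < cr G1 a < 1 /\ 0 < cr G3 a < 1) /\
  (forall a, 0 <= a < 1 -> 0 < cr G2 a < 1) /\
  (forall a, 0 < a <= 1 -> 0 < cz G1 a /\ 0 < cz G3 a) /\
  (forall a, 0 <= a <= 1 -> 0 < cz G2 a) /\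
  (exists r1s r3s z2s rb zb : R,
      0 < r1s < r3s /\ r3s < 1 /\ 0 < z2s /\ 0 < rb < 1 /\ 0 < zb /\
      at_point G1 0 r1s 0 /\ at_point G1 1 rb zb /\
      at_point G2 0 rb zb /\ at_point G2 1 1 z2s /\
      at_point G3 0 r3s 0 /\ at_point G3 1 rb zb /\
      meet_only_at G1 G2 rb zb /\ meet_only_at G1 G3 rb zb /\
      meet_only_at G2 G3 rb zb) /\
  (const_speed G1 /\ const_speed G2 /\ const_speed G3) /\
  (exists lambda : R, forall a, I01 a ->
      mean_curv G1 a = lambda /\ mean_curv G2 a = lambda /\ mean_curv G3 a = 0) /\
  (exists th1 th2 th3 : R -> R,
      is_angle G1 th1 /\ is_angle G2 th2 /\ is_angle G3 th3 /\
      th1 0 = thc /\ th2 1 = 0 /\ th3 0 = PI / 2 /\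
      - th1 1 + th3 1 = beta /\ th2 0 - th3 1 = - PI + beta) /\
  (simple_curve G1 /\ simple_curve G2 /\ simple_curve G3).

(** Equality of configurations: junk values outside [0,1] are ignored. *)
Definition same_curve (G G' : curve) : Prop :=
  forall a, I01 a -> cr G a = cr G' a /\ cz G a = cz G' a.

Definition same_config (S S' : config) : Prop :=
  same_curve (Gam1 S) (Gam1 S') /\ same_curve (Gam2 S) (Gam2 S') /\
  same_curve (Gam3 S) (Gam3 S').

Definition r3star (S : config) : R := cr (Gam3 S) 0.

Definition A_sigma (S : config) : R * R := (r3star S, arclength (Gam3 S)).

(** [f] induces a bijection from [P] modulo [eqv] onto [Q]; the direction
    [eqv x x' -> f x = f x'] is well-definedness on classes. *)
Definition bijective_mod {X Y : Type} (eqv : X -> X -> Prop) (f : X -> Y)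
    (P : X -> Prop) (Q : Y -> Prop) : Prop :=
  (forall x, P x -> Q (f x)) /\
  (forall x x', P x -> P x' -> (eqv x x' <-> f x = f x')) /\
  (forall y, Q y -> exists x, P x /\ f x = y).

Definition Omega0 (A sigma : R) : Prop :=
  0 < A < 1 /\ 0 < sigma < sqrt (1 - A ^ 2).

Definition arccosh (x : R) : R := ln (x + sqrt (x ^ 2 - 1)).

Lemma arccosh_ge0 (x : R) : 1 <= x -> 0 <= arccosh x.
Proof.
intros hx; unfold arccosh; rewrite <- ln_1.
assert (h := sqrt_pos (x ^ 2 - 1)).
apply ln_le; lra.
Qed.

Lemma cosh_arccosh (x : R) : 1 <= x -> cosh (arccosh x) = x.
Proof.
intros hx; unfold cosh, arccosh.
assert (h := sqrt_pos (x ^ 2 - 1)).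
assert (h2 : sqrt (x ^ 2 - 1) * sqrt (x ^ 2 - 1) = x ^ 2 - 1)
  by (apply sqrt_sqrt; nra).
rewrite exp_Ropp, exp_ln by lra.
set (s := sqrt (x ^ 2 - 1)) in *.
replace (/ (x + s)) with (x - s); [lra|].
apply (Rmult_eq_reg_r (x + s)); [|lra].
rewrite Rinv_l by lra; nra.
Qed.

Definition rbar (A sigma : R) : R := sqrt (sigma ^ 2 + A ^ 2).

Definition zbar (A sigma : R) : R := A * arccosh (rbar A sigma / A).

Definition theta3bar (A sigma : R) : R := asin (A / rbar A sigma).

Definition theta1bar (A sigma beta : R) : R := theta3bar A sigma - beta.

Definition lam (A sigma beta : R) : R :=
  (A * cos beta + sigma * sin beta) / (1 - A ^ 2 - sigma ^ 2).

Definition a_ell (A sigma beta : R) : R :=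
  sqrt (((2 * A ^ 2 + 2 * sigma ^ 2 - 1) * A * cos beta + sigma * sin beta)
        / (A * cos beta + sigma * sin beta)).

Definition z1 (A sigma beta theta : R) : R :=
  zbar A sigma
  - 1 / (2 * lam A sigma beta)
    * RInt (fun x =>
              sin x ^ 2
                / sqrt (sin x ^ 2
                        + 4 * lam A sigma beta ^ 2 * a_ell A sigma beta ^ 2)
              - sin x)
        (theta1bar A sigma beta) theta.

(* Main.v *)
Require Import Defs.
From Stdlib Require Import Ranalysis5 IndefiniteDescription.

(** Along a meridian of constant mean curvature [H], with tangent angle [th], the quantity
    [r * sin th - H * r ^ 2] is constant.  This has two consequences.  First, [r ^ 2] and
    [r * cos th] solve a linear system in the arclength, so the drop [Gam1] and the outer
    surface [Gam2], the latter reversed and reflected, are arcs of explicit nodoids that leave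
    a circle horizontally ([flow_arc]), and [Gam3], with [H = 0], is a catenary
    ([curve_is_catenary]).  Second, read at the ends of the curves it expresses the curvature
    and the contact radius of the drop through [A], [sg] and [beta], as [lam] and [a_ell].  The
    tangent angle of a nodoid arc is strictly monotone, so the prescribed angles fix the length
    of each arc.  A steady state is therefore determined by [(A, sg)]
    ([steady_state_explicit], [explicit_config_unique]), and one condition is left: the
    drop and the catenary must reach the junction at the same height, that is
    [z1 A sg beta PI = 0] ([arc_height], [z1_closing]).

    Since the junction lies inside the cylinder, [sg ^ 2 < 1 - A ^ 2]: near [A = 1] the
    catenary is short, the curvature [lam] is large and negative, and the drop is thin, with an
    almost circular meridian of radius [- 1 / (2 * lam)].  After multiplication by
    [2 * junction_lift], which removes the large curvature, the closing condition is a strictly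
    increasing function of [sg] whose derivative is close to [- 2 * cos beta], up to
    nonnegative terms and a perturbation with a small Lipschitz constant ([closing_incr]).  It
    changes sign ([closing_root]), so it has exactly one root [sigma A].  Monotonicity also
    gives the continuity of [sigma] ([root_continuous]), and [sg ^ 2 < 1 - A ^ 2] gives its
    limit.

    Conversely the three explicit curves form a steady state ([steady_state_exists]).  The drop
    starts inwards, rises while its radius stays below [a_ell < A], passes its top and descends
    to the junction from above; the catenary stays within [A <= r <= rbar], and the outer
    surface within [rbar <= r <= 1].  Hence the curves meet at the junction only. *)

(** * Calculus on the unit interval *)

Lemma derive_zero_const (f df : R -> R) (a b : R) :
  a <= b ->
  (forall x, a < x < b -> is_derive f x (df x)) ->
  (forall x, a <= x <= b -> continuity_pt f x) ->
  (forall x, a < x < b -> df x = 0) ->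
  forall x, a <= x <= b -> f x = f a.
Proof.
intros hab hd hc hz x hx.
destruct (MVT_gen f a x (fun _ => 0)) as [c [_ hc2]].
- rewrite Rmin_left, Rmax_right by lra. intros y hy.
  rewrite <- (hz y) by lra. apply hd; lra.
- rewrite Rmin_left, Rmax_right by lra. intros y hy. apply hc; lra.
- lra.
Qed.

Lemma is_derive_continuity_pt (f : R -> R) (x l : R) :
  is_derive f x l -> continuity_pt f x.
Proof.
intros h. apply derivable_continuous_pt. exists l. now apply is_derive_Reals.
Qed.

(** The derivative is only controlled in the open interval: the curvature equations are
    used there, where two-sided derivatives exist. *)
Lemma derive_zero_const01 (f df : R -> R) :
  (forall x, is_derive f x (df x)) ->
  (forall x, 0 < x < 1 -> df x = 0) ->
  forall x, I01 x -> f x = f 0.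
Proof.
intros hd hz. apply (derive_zero_const f df 0 1); auto; [lra|].
intros y _; apply (is_derive_continuity_pt f y (df y)), hd.
Qed.

Lemma derive_neg_decreasing (f df : R -> R) (a b : R) :
  (forall x, is_derive f x (df x)) ->
  (forall x, a < x < b -> df x < 0) ->
  a < b -> f b < f a.
Proof.
intros hd hn hab.
destruct (MVT_cor2 f df a b hab) as [c [h1 h2]].
- intros; apply is_derive_Reals, hd.
- specialize (hn c h2). nra.
Qed.

Lemma derive_pos_increasing (f df : R -> R) (a b : R) :
  (forall x, is_derive f x (df x)) ->
  (forall x, a < x < b -> 0 < df x) ->
  a < b -> f a < f b.
Proof.
intros hd hn hab.
destruct (MVT_cor2 f df a b hab) as [c [h1 h2]].
- intros; apply is_derive_Reals, hd.
- specialize (hn c h2). nra.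
Qed.

Lemma Derive_eq (f df : R -> R) : (forall x, is_derive f x (df x)) ->
  forall x, Derive (fun y : R => f y) x = df x.
Proof. intros h x. apply is_derive_unique, h. Qed.

(** Precomposition with this retraction turns relative continuity on [0,1] into
    continuity on the line. *)
Definition clamp (x : R) : R := Rmax 0 (Rmin 1 x).

Lemma clamp_I01 (x : R) : I01 (clamp x).
Proof. unfold I01, clamp, Rmax, Rmin; repeat destruct Rle_dec; lra. Qed.

Lemma clamp_id (x : R) : I01 x -> clamp x = x.
Proof. unfold I01, clamp, Rmax, Rmin; intros; repeat destruct Rle_dec; lra. Qed.

Lemma clamp_lip (x y : R) : Rabs (clamp x - clamp y) <= Rabs (x - y).
Proof.
unfold clamp, Rmax, Rmin, Rabs; repeat destruct Rle_dec; repeat destruct Rcase_abs; lra.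
Qed.

Lemma continuous_clamp (f : R -> R) :
  (forall x, I01 x -> continue_in f I01 x) ->
  forall x, continuous (fun y => f (clamp y)) x.
Proof.
intros hf x. apply continuity_pt_filterlim.
intros eps heps.
destruct (hf (clamp x) (clamp_I01 x) eps heps) as [alp [ha h]].
exists alp; split; [exact ha|]. intros y [_ hy]. simpl in *.
destruct (Req_dec (clamp x) (clamp y)) as [e|e].
- rewrite <- e. unfold Rdist. rewrite Rminus_diag, Rabs_R0. exact heps.
- apply h. split; [split; [apply clamp_I01 | exact e]|].
  unfold Rdist in *. apply Rle_lt_trans with (2 := hy). apply clamp_lip.
Qed.

Lemma continuous_continue_in (f : R -> R) (D : R -> Prop) (x : R) :
  continuous f x -> continue_in f D x.
Proof.
intros h. apply continuity_pt_filterlim in h.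
intros eps heps. destruct (h eps heps) as [alp [ha h']].
exists alp; split; [exact ha|]. intros y [[_ hne] hy].
apply h'. split; [split; [exact I| exact hne] | exact hy].
Qed.

Lemma D_in_interior (f d : R -> R) (x : R) :
  0 < x < 1 -> D_in f d I01 x -> is_derive f x (d x).
Proof.
intros hx h. apply is_derive_Reals.
intros eps heps. destruct (h eps heps) as [alp [ha h']].
assert (hp : 0 < Rmin alp (Rmin x (1 - x))) by (repeat apply Rmin_pos; lra).
exists (mkposreal _ hp). intros u hu hlt. simpl in hlt.
assert (h1 := Rmin_l alp (Rmin x (1 - x))).
assert (h2 := Rmin_r alp (Rmin x (1 - x))).
assert (h3 := Rmin_l x (1 - x)). assert (h4 := Rmin_r x (1 - x)).
specialize (h' (x + u)). simpl in h'. unfold Rdist in h'.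
replace (x + u - x) with u in h' by ring.
apply h'. split; [split|].
- apply Rabs_def2 in hlt. unfold I01; lra.
- lra.
- lra.
Qed.

Lemma is_derive_D_in (f d : R -> R) (D : R -> Prop) (x : R) :
  is_derive f x (d x) -> D_in f d D x.
Proof.
intros h. apply is_derive_Reals in h.
intros eps heps. destruct (h eps heps) as [alp h'].
exists alp; split; [apply cond_pos|]. intros y [[_ hne] hy]. simpl in *.
unfold Rdist in *. specialize (h' (y - x)).
replace (x + (y - x)) with y in h' by ring. apply h'; lra.
Qed.

Lemma RInt_antiderivative (f : R -> R) (a x : R) :
  (forall y, continuous f y) -> is_derive (fun t => RInt f a t) x (f x).
Proof.
intros hf. apply (is_derive_RInt f _ a).
- apply filter_forall; intros y. apply (@RInt_correct R_CompleteNormedModule).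
  apply (@ex_RInt_continuous R_CompleteNormedModule); intros; apply hf.
- apply hf.
Qed.

(** Relative derivatives are two-sided in the interior, where the difference of the two
    functions therefore has derivative 0; continuity carries this to the endpoints. *)
Lemma D_in_determined (f d e : R -> R) :
  (forall x, I01 x -> D_in f d I01 x) ->
  (forall x, I01 x -> is_derive e x (d x)) ->
  e 0 = f 0 -> forall x, I01 x -> e x = f x.
Proof.
intros hf he h0 x hx.
assert (hc : forall y, continuous (fun t => f (clamp t)) y).
{ apply continuous_clamp. intros y hy. apply (cont_deriv f d), hf, hy. }
assert (hd : forall y, 0 < y < 1 -> is_derive (fun t => f (clamp t)) y (d y)).
{ intros y hy. apply is_derive_ext_loc with (f := f).
  - apply (locally_interval _ y 0 1); simpl; try lra.
    intros t h1 h2; simpl in *. rewrite clamp_id; [reflexivity|unfold I01; lra].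
  - apply D_in_interior; [exact hy|]. apply hf; unfold I01; lra. }
assert (h := derive_zero_const (fun t => f (clamp t) - e t) (fun t => 0) 0 1).
assert (e1 : f (clamp x) - e x = f (clamp 0) - e 0).
{ apply h; try lra; try exact hx; auto.
  - intros y hy. rewrite <- (Rminus_diag (d y)).
    apply (is_derive_minus (fun t => f (clamp t)) e); [apply hd, hy|].
    apply he; unfold I01; lra.
  - intros y hy. apply continuity_pt_minus.
    + apply continuity_pt_filterlim, hc.
    + apply (is_derive_continuity_pt e y (d y)), he, hy. }
rewrite !clamp_id in e1 by (unfold I01 in *; lra). lra.
Qed.

(** Integrating the clamped second derivative twice gives an extension to the line, so that
    one-sided derivatives at 0 and 1 need no separate treatment afterwards. *)
Lemma C2fun_extend (f : C2fun) :
  exists e0 e1 e2 : R -> R,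
    (forall x, is_derive e0 x (e1 x)) /\ (forall x, is_derive e1 x (e2 x)) /\
    (forall x, I01 x -> e0 x = f x /\ e1 x = d1 f x /\ e2 x = d2 f x).
Proof.
set (e2 := fun x => d2 f (clamp x)).
assert (c2 : forall x, continuous e2 x) by (apply continuous_clamp, d2_cont).
set (e1 := fun x => d1 f 0 + RInt e2 0 x).
assert (D1 : forall x, is_derive e1 x (e2 x)).
{ intros x. unfold e1. rewrite <- (Rplus_0_l (e2 x)).
  apply (is_derive_plus (fun _ => d1 f 0) (RInt e2 0)).
  - apply (@is_derive_const R_AbsRing).
  - apply RInt_antiderivative, c2. }
assert (E1 : forall x, I01 x -> e1 x = d1 f x).
{ apply (D_in_determined _ (d2 f)); [apply d2_spec | |].
  { intros x hx. rewrite <- (clamp_id x hx) at 2. apply D1. }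
  unfold e1. rewrite RInt_point. unfold zero; simpl; ring. }
assert (c1 : forall x, continuous e1 x).
{ intros x. apply continuity_pt_filterlim. eapply is_derive_continuity_pt, D1. }
set (e0 := fun x => f 0 + RInt e1 0 x).
assert (D0 : forall x, is_derive e0 x (e1 x)).
{ intros x. unfold e0. rewrite <- (Rplus_0_l (e1 x)).
  apply (is_derive_plus (fun _ => fn f 0) (RInt e1 0)).
  - apply (@is_derive_const R_AbsRing).
  - apply RInt_antiderivative, c1. }
exists e0, e1, e2; split; [exact D0|]; split; [exact D1|].
intros x hx; split; [|split; [apply E1, hx|unfold e2; now rewrite clamp_id]].
revert x hx. apply (D_in_determined f (d1 f)); [apply d1_spec| |].
- intros x hx. rewrite <- (E1 x hx). apply D0.
- unfold e0. rewrite RInt_point. unfold zero; simpl; ring.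
Qed.

Definition C2_of_derivatives (f f1 f2 : R -> R)
    (h1 : forall x, is_derive f x (f1 x)) (h2 : forall x, is_derive f1 x (f2 x))
    (h3 : forall x, continuous f2 x) : C2fun :=
  mkC2fun f f1 f2
    (fun x _ => is_derive_D_in f f1 I01 x (h1 x))
    (fun x _ => is_derive_D_in f1 f2 I01 x (h2 x))
    (fun x _ => continuous_continue_in f2 I01 x (h3 x)).

(** * Nodoid arcs *)

(** Meridian arc of the nodoid of mean curvature [- 1 / (2 * b)] that leaves the circle of
    radius [a] horizontally, towards the axis; [t] is arclength divided by [b].  The complex
    number [r * exp (i * th)] is [- (a - i * b) * exp (- i * t) - i * b], whose modulus and
    argument are elementary: with [X] and [Y] below it equals
    [- exp (- i * t) * (X - i * Y)]. *)
Definition arc_X (a b t : R) : R := a - b * sin t.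
Definition arc_Y (b t : R) : R := b * (1 - cos t).
Definition arc_r (a b t : R) : R := sqrt (arc_X a b t ^ 2 + arc_Y b t ^ 2).
(** For [b < a] the real part [X] is positive, so the arctangent is a continuous branch of
    the argument along the whole arc. *)
Definition arc_th (a b t : R) : R := PI - t - atan (arc_Y b t / arc_X a b t).
Definition arc_dth (a b t : R) : R := - (1 + a ^ 2 / arc_r a b t ^ 2) / 2.
Definition arc_z (a b t : R) : R := RInt (fun x => b * sin (arc_th a b x)) 0 t.

Lemma arc_X_pos (a b t : R) : 0 < b < a -> 0 < arc_X a b t.
Proof. intros h. unfold arc_X. assert (h' := SIN_bound t). nra. Qed.

Lemma arc_r_pos (a b t : R) : 0 < b < a -> 0 < arc_r a b t.
Proof.
intros h. apply sqrt_lt_R0. assert (h' := arc_X_pos a b t h). nra.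
Qed.

Lemma arc_r_sqr (a b t : R) :
  arc_r a b t ^ 2 = arc_X a b t ^ 2 + arc_Y b t ^ 2.
Proof. unfold arc_r. rewrite pow2_sqrt; [reflexivity|nra]. Qed.

Lemma arc_r_atan (a b t : R) : 0 < b < a ->
  arc_r a b t = arc_X a b t * sqrt (1 + (arc_Y b t / arc_X a b t) ^ 2).
Proof.
intros h. assert (hX := arc_X_pos a b t h).
unfold arc_r. rewrite <- (sqrt_pow2 (arc_X a b t)) at 2 by lra.
rewrite <- sqrt_mult by nra. f_equal. field. lra.
Qed.

Lemma arc_cos (a b t : R) : 0 < b < a ->
  arc_r a b t * cos (arc_th a b t) = b * sin t - a * cos t.
Proof.
intros h. assert (hX := arc_X_pos a b t h).
rewrite arc_r_atan by exact h. unfold arc_th.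
set (y := arc_Y b t / arc_X a b t).
replace (PI - t - atan y) with (PI - (t + atan y)) by ring.
rewrite Rtrigo_facts.cos_pi_minus, cos_plus, cos_atan, sin_atan.
assert (hs : 0 < sqrt (1 + y ^ 2)) by (apply sqrt_lt_R0; nra).
replace (1 + y²) with (1 + y ^ 2) by (unfold Rsqr; ring).
transitivity (- (arc_X a b t * cos t - arc_X a b t * y * sin t)); [field; lra|].
unfold y. replace (arc_X a b t * (arc_Y b t / arc_X a b t)) with (arc_Y b t)
  by (field; lra).
unfold arc_X, arc_Y. ring.
Qed.

Lemma arc_sin (a b t : R) : 0 < b < a ->
  arc_r a b t * sin (arc_th a b t) = a * sin t - b * (1 - cos t).
Proof.
intros h. assert (hX := arc_X_pos a b t h).
rewrite arc_r_atan by exact h. unfold arc_th.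
set (y := arc_Y b t / arc_X a b t).
replace (PI - t - atan y) with (PI - (t + atan y)) by ring.
rewrite Rtrigo_facts.sin_pi_minus, sin_plus, cos_atan, sin_atan.
assert (hs : 0 < sqrt (1 + y ^ 2)) by (apply sqrt_lt_R0; nra).
replace (1 + y²) with (1 + y ^ 2) by (unfold Rsqr; ring).
transitivity (arc_X a b t * sin t + arc_X a b t * y * cos t); [field; lra|].
unfold y. replace (arc_X a b t * (arc_Y b t / arc_X a b t)) with (arc_Y b t)
  by (field; lra).
unfold arc_X, arc_Y. assert (e := sin2_cos2 t). unfold Rsqr in e.
assert (e' : b * (sin t * sin t + cos t * cos t) = b * 1) by now rewrite e.
lra.
Qed.

(** Constancy of [r * sin th - H * r ^ 2], with [H = - 1 / (2 * b)]. *)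
Lemma arc_first_integral (a b t : R) : 0 < b < a ->
  arc_r a b t ^ 2 - a ^ 2 = - 2 * b * (arc_r a b t * sin (arc_th a b t)).
Proof.
intros h. rewrite arc_sin by exact h. rewrite arc_r_sqr. unfold arc_X, arc_Y.
assert (e := sin2_cos2 t). unfold Rsqr in e.
assert (e' : b ^ 2 * (sin t * sin t + cos t * cos t) = b ^ 2 * 1) by now rewrite e.
lra.
Qed.

Lemma arc_r_derive (a b t : R) : 0 < b < a ->
  is_derive (arc_r a b) t (b * cos (arc_th a b t)).
Proof.
intros h. assert (hr := arc_r_pos a b t h). assert (hX := arc_X_pos a b t h).
assert (hc := arc_cos a b t h).
replace (b * cos (arc_th a b t)) with (b * (b * sin t - a * cos t) / arc_r a b t)
  by (rewrite <- hc; field; lra).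
assert (hp : 0 < arc_X a b t ^ 2 + arc_Y b t ^ 2) by nra.
unfold arc_r, arc_X, arc_Y in *. auto_derive.
{ apply Rlt_le_trans with (1 := hp); right; ring. }
set (q := sqrt _). assert (0 < q) by exact hr.
replace (sqrt _) with q by (unfold q; f_equal; ring).
field. lra.
Qed.

Lemma arc_th_derive (a b t : R) : 0 < b < a ->
  is_derive (arc_th a b) t (arc_dth a b t).
Proof.
intros h. assert (hr := arc_r_pos a b t h). assert (hX := arc_X_pos a b t h).
assert (hp := arc_r_sqr a b t).
assert (hq : 0 < arc_r a b t ^ 2) by nra.
assert (e := sin2_cos2 t). unfold Rsqr in e.
assert (e' : b ^ 2 * (sin t * sin t + cos t * cos t) = b ^ 2 * 1) by now rewrite e.
set (N := b * sin t * arc_X a b t + arc_Y b t * (b * cos t)).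
assert (hN : a ^ 2 = arc_r a b t ^ 2 + 2 * N)
  by (rewrite hp; unfold N, arc_X, arc_Y; lra).
unfold arc_dth. rewrite hN.
replace (- (1 + (arc_r a b t ^ 2 + 2 * N) / arc_r a b t ^ 2) / 2)
  with (- 1 - N / arc_r a b t ^ 2) by (field; lra).
rewrite hp in *. unfold N, arc_th. clear hN N hp.
unfold arc_X, arc_Y in *. auto_derive; [lra|].
unfold Rsqr. field. split; [|lra].
apply Rgt_not_eq. apply Rlt_le_trans with (1 := hq). right; ring.
Qed.

Lemma arc_th_continuous (a b t : R) : 0 < b < a -> continuous (arc_th a b) t.
Proof. intros h. apply (ex_derive_continuous (arc_th a b)). eexists. now apply
  arc_th_derive. Qed.

Lemma arc_z_derive (a b t : R) : 0 < b < a ->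
  is_derive (arc_z a b) t (b * sin (arc_th a b t)).
Proof.
intros h. apply (RInt_antiderivative (fun x => b * sin (arc_th a b x)) 0).
intros y. apply (ex_derive_continuous (fun x => b * sin (arc_th a b x))).
auto_derive. eexists; now apply arc_th_derive.
Qed.

Lemma arc_dth_neg (a b t : R) : 0 < b < a -> arc_dth a b t < 0.
Proof.
intros h. assert (hr := arc_r_pos a b t h). unfold arc_dth.
assert (0 < a ^ 2 / arc_r a b t ^ 2) by (apply Rdiv_lt_0_compat; nra). lra.
Qed.

Lemma arc_th_decr (a b t u : R) : 0 < b < a -> t < u -> arc_th a b u < arc_th a b t.
Proof.
intros h. apply (derive_neg_decreasing _ (arc_dth a b)).
- intros; now apply arc_th_derive.
- intros; now apply arc_dth_neg.
Qed.

Lemma arc_th_inj (a b t u : R) : 0 < b < a -> arc_th a b t = arc_th a b u -> t = u.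
Proof.
intros h e. destruct (Rtotal_order t u) as [l|[l|l]]; [|exact l|];
  apply (arc_th_decr a b) in l; auto; lra.
Qed.

Lemma arc_th_decr_le (a b t u : R) :
  0 < b < a -> t <= u -> arc_th a b u <= arc_th a b t.
Proof.
intros h [l|l]; [left; now apply arc_th_decr | right; now rewrite l].
Qed.

Lemma arc_th_0 (a b : R) : arc_th a b 0 = PI.
Proof.
unfold arc_th, arc_Y. rewrite cos_0.
replace (b * (1 - 1) / arc_X a b 0) with 0 by (unfold Rdiv; ring).
rewrite atan_0. ring.
Qed.

Lemma arc_th_2PI (a b : R) : arc_th a b (2 * PI) = - PI.
Proof.
unfold arc_th, arc_Y. rewrite cos_2PI.
replace (b * (1 - 1) / arc_X a b (2 * PI)) with 0 by (unfold Rdiv; ring).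
rewrite atan_0. ring.
Qed.

Lemma arc_r_0 (a b : R) : 0 < a -> arc_r a b 0 = a.
Proof.
intros h. unfold arc_r, arc_X, arc_Y. rewrite cos_0, sin_0.
replace ((a - b * 0) ^ 2 + (b * (1 - 1)) ^ 2) with (a ^ 2) by ring.
apply sqrt_pow2; lra.
Qed.

Lemma arc_z_0 (a b : R) : arc_z a b 0 = 0.
Proof. unfold arc_z. now rewrite RInt_point. Qed.

(** One period of the arc turns the tangent clockwise by a full revolution. *)
Lemma arc_th_surj (a b y : R) : 0 < b < a -> - PI < y < PI ->
  exists t, 0 < t /\ arc_th a b t = y.
Proof.
intros h hy. assert (hpi := PI_RGT_0).
destruct (IVT_interv (fun t => y - arc_th a b t) 0 (2 * PI)) as [t [ht e]].
- intros t _. apply continuity_pt_minus; [apply continuity_pt_const; now intro|].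
  apply continuity_pt_filterlim, arc_th_continuous, h.
- lra.
- rewrite arc_th_0; lra.
- rewrite arc_th_2PI; lra.
- exists t; split; [|lra].
  destruct (proj1 ht) as [l|l]; [exact l|]. rewrite <- l, arc_th_0 in e. lra.
Qed.

(** Minus the integrand of [z1], with [q = 2 * lam * a_ell] up to sign; the tangent angle
    is the variable. *)
Definition height_density (q x : R) : R :=
  sin x - sin x ^ 2 / sqrt (sin x ^ 2 + q ^ 2).

Lemma height_density_continuous (q x : R) : 0 < q -> continuous (height_density q) x.
Proof.
intros h. apply (ex_derive_continuous (height_density q)). unfold height_density.
auto_derive. assert (0 < sin x ^ 2 + q ^ 2) by nra.
assert (0 < sqrt (sin x ^ 2 + q ^ 2)) by now apply sqrt_lt_R0.
simpl in *. repeat split; auto; lra.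
Qed.

(** The positive root of the first integral, seen as a quadratic equation in [r]. *)
Lemma arc_r_of_angle (a b t : R) : 0 < b < a ->
  arc_r a b t
  = b * (sqrt (sin (arc_th a b t) ^ 2 + (a / b) ^ 2) - sin (arc_th a b t)).
Proof.
intros h. assert (hf := arc_first_integral a b t h).
assert (hr := arc_r_pos a b t h). set (S := sin (arc_th a b t)) in *.
set (r := arc_r a b t) in *.
assert (e : sqrt (S ^ 2 + (a / b) ^ 2) = (r + b * S) / b).
{ apply sqrt_lem_1.
  - nra.
  -     assert (hS := SIN_bound (arc_th a b t)). fold S in hS.
    apply Rlt_le, Rdiv_lt_0_compat; [|lra].
    destruct (Rle_lt_dec 0 S); [nra|].
    nra.
  - apply (Rmult_eq_reg_r (b ^ 2)); [|nra]. field_simplify; [|lra|lra]. nra. }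
rewrite e. field. lra.
Qed.

(** Along a nodoid arc the tangent angle decreases strictly, so the height can be integrated
    over the angle instead of the arclength; this is the integral that appears in [z1]. *)
Lemma arc_height (a b t : R) : 0 < b < a ->
  arc_z a b t = b * RInt (height_density (a / b)) (arc_th a b t) PI.
Proof.
intros h.
assert (hq : 0 < a / b) by (apply Rdiv_lt_0_compat; lra).
set (F := fun t => arc_z a b t + b * RInt (height_density (a / b)) PI (arc_th a b t)).
assert (hF : forall x, is_derive F x 0).
{ intros x.
  assert (hr := arc_r_pos a b x h). assert (hX := arc_X_pos a b x h).
  replace 0 with (b * sin (arc_th a b x)
                 + b * (arc_dth a b x * height_density (a / b) (arc_th a b x))).
  - apply (is_derive_plus (arc_z a b)); [now apply arc_z_derive|].
    apply (is_derive_scal (fun x => RInt (height_density (a / b)) PI (arc_th a b x))).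
    apply (is_derive_comp (RInt (height_density (a / b)) PI) (arc_th a b)).
    + apply RInt_antiderivative. intros; now apply height_density_continuous.
    + now apply arc_th_derive.
  - assert (e1 := arc_r_of_angle a b x h).
    assert (e2 := arc_first_integral a b x h).
    unfold arc_dth, height_density.
    assert (hD : 0 < sqrt (sin (arc_th a b x) ^ 2 + (a / b) ^ 2))
      by (apply sqrt_lt_R0; nra).
    set (D := sqrt _) in *. set (S := sin _) in *. set (r := arc_r a b x) in *.
    assert (ea : a ^ 2 = r ^ 2 + 2 * b * (r * S)) by lra.
    rewrite ea.
    assert (eD : D = (r + b * S) / b) by (rewrite e1; field; lra).
    assert (0 < r + b * S).
    { assert (r + b * S = b * D) by (rewrite e1; ring). nra. }
    rewrite eD. field. repeat split; lra. }
assert (hc : F t = F 0).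
{ destruct (Rle_lt_dec 0 t) as [l|l].
  - apply (derive_zero_const F (fun _ => 0) 0 t); auto; try lra.
    intros; now apply (is_derive_continuity_pt F x 0).
  - symmetry. apply (derive_zero_const F (fun _ => 0) t 0); auto; try lra.
    intros; now apply (is_derive_continuity_pt F x 0). }
unfold F in hc. rewrite arc_th_0, RInt_point, arc_z_0 in hc.
rewrite <- (opp_RInt_swap (height_density (a / b)) PI (arc_th a b t)).
- unfold zero, opp in *; simpl in *. lra.
- apply (@ex_RInt_continuous R_CompleteNormedModule).
  intros; now apply height_density_continuous.
Qed.

(** * Rigidity of arclength-parametrised curves of constant mean curvature *)

(** A meridian of constant mean curvature [H] at constant speed [L], with unit tangent
    [(u, v)].  Everything is defined on the line, but the curvature equation is only imposed
    on the interval. *)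
Record flow (H L : R) (r z u v du dv : R -> R) : Prop := mkFlow {
  flow_len : 0 < L;
  flow_r : forall x, is_derive r x (L * u x);
  flow_z : forall x, is_derive z x (L * v x);
  flow_u : forall x, is_derive u x (du x);
  flow_v : forall x, is_derive v x (dv x);
  flow_pos : forall x, I01 x -> 0 < r x;
  flow_unit : forall x, I01 x -> u x ^ 2 + v x ^ 2 = 1;
  flow_du : forall x, 0 < x < 1 -> du x = - L * (2 * H - v x / r x) * v x;
  flow_dv : forall x, 0 < x < 1 -> dv x = L * (2 * H - v x / r x) * u x
}.

Lemma Rpower_3_2 (c : R) : 0 < c -> Rpower c (3 / 2) = sqrt c ^ 3.
Proof.
intros h. replace (3 / 2) with (1 + / 2) by field.
rewrite Rpower_plus, Rpower_1, Rpower_sqrt by exact h.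
rewrite <- (sqrt_sqrt c) at 1 by lra. ring.
Qed.

Lemma arclength_const_speed (G : curve) (c : R) :
  (forall a, I01 a -> speed2 G a = c) -> arclength G = sqrt c.
Proof.
intros h. unfold arclength.
rewrite (RInt_ext _ (fun _ => sqrt c)).
- rewrite RInt_const. unfold scal; simpl; unfold mult; simpl. ring.
- rewrite Rmin_left, Rmax_right by lra. intros x hx.
  rewrite h; [reflexivity|unfold I01; lra].
Qed.

(** Constant speed makes the acceleration normal to the velocity, so the mean curvature
    equation determines both second derivatives. *)
Lemma curve_flow (G : curve) (H : R) (th : R -> R) :
  (forall a, I01 a -> 0 < cr G a) -> const_speed G ->
  (forall a, I01 a -> mean_curv G a = H) -> is_angle G th ->
  exists r z u v du dv, flow H (arclength G) r z u v du dv /\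
    forall x, I01 x -> r x = cr G x /\ z x = cz G x /\
                       cos (th x) = u x /\ sin (th x) = v x.
Proof.
intros hpos [c [hc hs]] hH hth.
rewrite (arclength_const_speed G c hs).
set (L := sqrt c).
assert (hL : 0 < L) by now apply sqrt_lt_R0.
assert (hLc : L * L = c) by (apply sqrt_sqrt; lra).
destruct (C2fun_extend (cr G)) as [r0 [r1 [r2 [hr0 [hr1 hr]]]]].
destruct (C2fun_extend (cz G)) as [z0 [z1 [z2 [hz0 [hz1 hz]]]]].
assert (hsp : forall x, I01 x -> r1 x ^ 2 + z1 x ^ 2 = c).
{ intros x hx. destruct (hr x hx) as [_ [e1 _]]. destruct (hz x hx) as [_ [e2 _]].
  rewrite e1, e2. now apply hs. }
assert (hort : forall x, 0 < x < 1 -> r1 x * r2 x + z1 x * z2 x = 0).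
{ intros x hx.
  assert (h1 : is_derive (fun x => r1 x ^ 2 + z1 x ^ 2) x
                 (2 * (r1 x * r2 x + z1 x * z2 x))).
  { auto_derive.
    - split; [eexists; apply hr1|split; [eexists; apply hz1|exact I]].
    - rewrite (Derive_eq r1 r2 hr1).
      rewrite (Derive_eq z1 z2 hz1). ring. }
  assert (h2 : is_derive (fun x => r1 x ^ 2 + z1 x ^ 2) x 0).
  { apply (is_derive_ext_loc (fun _ => c)).
    - apply (locally_interval _ x 0 1); simpl; try lra.
      intros t ht1 ht2; simpl in *. symmetry; apply hsp; unfold I01; lra.
    - apply (@is_derive_const R_AbsRing). }
  apply is_derive_unique in h1. apply is_derive_unique in h2. lra. }
assert (hk : forall x, 0 < x < 1 ->
  r1 x * z2 x - z1 x * r2 x = (2 * H - (z1 x / L) / r0 x) * L ^ 3).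
{ intros x hx. assert (hx' : I01 x) by (unfold I01; lra).
  assert (e := hH x hx'). unfold mean_curv in e. rewrite (hs x hx') in e.
  rewrite Rpower_3_2 in e by exact hc. fold L in e.
  destruct (hr x hx') as [e0 [e1 e2]]. destruct (hz x hx') as [_ [f1 f2]].
  rewrite <- e0, <- e1, <- e2, <- f1, <- f2 in e.
  assert (hp := hpos x hx'). rewrite <- e0 in hp.
  rewrite <- e. field. lra. }
exists r0, z0, (fun x => r1 x / L), (fun x => z1 x / L),
  (fun x => r2 x / L), (fun x => z2 x / L).
split.
- split.
  + exact hL.
  + intros x. replace (L * (r1 x / L)) with (r1 x) by (field; lra). apply hr0.
  + intros x. replace (L * (z1 x / L)) with (z1 x) by (field; lra). apply hz0.
  + intros x. unfold Rdiv. rewrite (Rmult_comm (r2 x)).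
    apply (is_derive_ext (fun t => / L * r1 t)); [intros; apply Rmult_comm|].
    now apply (is_derive_scal r1).
  + intros x. unfold Rdiv. rewrite (Rmult_comm (z2 x)).
    apply (is_derive_ext (fun t => / L * z1 t)); [intros; apply Rmult_comm|].
    now apply (is_derive_scal z1).
  + intros x hx. destruct (hr x hx) as [e0 _]. rewrite e0. now apply hpos.
  + intros x hx. assert (e := hsp x hx).
    apply (Rmult_eq_reg_r (L ^ 2)); [|nra]. field_simplify; [|lra]. nra.
  + intros x hx. assert (e := hk x hx). assert (o := hort x hx).
    assert (hx' : I01 x) by (unfold I01; lra). assert (p := hsp x hx').
    assert (E : r2 x * (L * L) = - (r1 x * z2 x - z1 x * r2 x) * z1 x).
    { rewrite hLc, <- p.
      replace (r2 x * (r1 x ^ 2 + z1 x ^ 2)) with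
       (r1 x * (r1 x * r2 x) + r2 x * z1 x ^ 2) by ring.
      replace (r1 x * r2 x) with (- (z1 x * z2 x)) by lra. ring. }
    rewrite e in E.
    apply (Rmult_eq_reg_r (L * L * L)); [|nra].
    transitivity (r2 x * (L * L)); [field; lra|]. rewrite E.
    assert (0 < r0 x) by (destruct (hr x hx') as [e0 _]; rewrite e0; now apply hpos).
    field. split; lra.
  + intros x hx. assert (e := hk x hx). assert (o := hort x hx).
    assert (hx' : I01 x) by (unfold I01; lra). assert (p := hsp x hx').
    assert (E : z2 x * (L * L) = (r1 x * z2 x - z1 x * r2 x) * r1 x).
    { rewrite hLc, <- p.
      replace (z2 x * (r1 x ^ 2 + z1 x ^ 2)) with
       (z1 x * (z1 x * z2 x) + z2 x * r1 x ^ 2) by ring.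
      replace (z1 x * z2 x) with (- (r1 x * r2 x)) by lra. ring. }
    rewrite e in E.
    apply (Rmult_eq_reg_r (L * L * L)); [|nra].
    transitivity (z2 x * (L * L)); [field; lra|]. rewrite E.
    assert (0 < r0 x) by (destruct (hr x hx') as [e0 _]; rewrite e0; now apply hpos).
    field. split; lra.
- intros x hx. destruct (hr x hx) as [e0 [e1 _]]. destruct (hz x hx) as [f0 [f1 _]].
  destruct (hth x hx) as [_ [_ [g1 g2]]]. rewrite hs in g1, g2 by exact hx.
  rewrite e1, f1. auto.
Qed.

(** Force balance for surfaces of revolution of constant mean curvature. *)
Lemma flow_first_integral (H L : R) (r z u v du dv : R -> R) :
  flow H L r z u v du dv -> forall x, I01 x ->
  r x * v x - H * r x ^ 2 = r 0 * v 0 - H * r 0 ^ 2.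
Proof.
intros F.
apply (derive_zero_const01 (fun x => r x * v x - H * r x ^ 2)
  (fun x => L * u x * v x + r x * dv x - 2 * H * r x * (L * u x))).
- intros x. auto_derive.
  + repeat split; eexists; [apply (flow_r _ _ _ _ _ _ _ _ F)|apply (flow_v _ _ _ _ _ _ _ _ F)
      |apply (flow_r _ _ _ _ _ _ _ _ F)].
  + rewrite (Derive_eq r _ (flow_r _ _ _ _ _ _ _ _ F)).
    rewrite (Derive_eq v _ (flow_v _ _ _ _ _ _ _ _ F)). ring.
- intros x hx. rewrite (flow_dv _ _ _ _ _ _ _ _ F x hx).
  assert (hp : 0 < r x) by (apply (flow_pos _ _ _ _ _ _ _ _ F); unfold I01; lra).
  field. lra.
Qed.

(** Reversing the orientation changes the sign of the curvature, and so does the reflection in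
    [z = 0]; together they preserve it.  This brings the outer surface, known at its end, to
    the form of an arc known at its beginning. *)
Lemma flow_reverse (H L : R) (r z u v du dv : R -> R) :
  flow H L r z u v du dv ->
  flow H L (fun x => r (1 - x)) (fun x => - z (1 - x))
    (fun x => - u (1 - x)) (fun x => v (1 - x))
    (fun x => du (1 - x)) (fun x => - dv (1 - x)).
Proof.
intros [f1 f2 f3 f4 f5 f6 f7 f8 f9].
assert (hd : forall f df : R -> R, (forall x, is_derive f x (df x)) ->
  forall x, is_derive (fun t => f (1 - t)) x (- df (1 - x))).
{ intros f df hf x. auto_derive.
  - eexists; apply hf.
  - rewrite (Derive_eq f df hf).
    replace (1 + - x) with (1 - x) by ring. ring. }
split; auto.
- intros x. replace (L * - u (1 - x)) with (- (L * u (1 - x))) by ring.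
  apply (hd r (fun x => L * u x)), f2.
- intros x. rewrite <- (Ropp_involutive (L * v (1 - x))).
  apply (is_derive_opp (fun x => z (1 - x))), (hd z (fun x => L * v x)), f3.
- intros x. rewrite <- (Ropp_involutive (du (1 - x))).
  apply (is_derive_opp (fun x => u (1 - x))), (hd u du), f4.
- intros x hx. apply f6. unfold I01 in *; lra.
- intros x hx. assert (hx' : I01 (1 - x)) by (unfold I01 in *; lra).
  assert (e := f7 (1 - x) hx'). lra.
- intros x hx. rewrite f8 by lra. ring.
- intros x hx. rewrite f9 by lra. ring.
Qed.

Lemma flow_rv (H L : R) (r z u v du dv : R -> R) : flow H L r z u v du dv ->
  v 0 = 0 -> forall x, I01 x -> r x * v x = H * (r x ^ 2 - r 0 ^ 2).
Proof.
intros F h x hx. assert (e := flow_first_integral _ _ _ _ _ _ _ _ F x hx).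
rewrite h in e. lra.
Qed.

(** The pair [(r ^ 2, r * u)] obeys a linear system with constant coefficients, because
    [(r * u)' = L * (1 - 2 * H * (r * v))] and the first integral expresses [r * v] through
    [r ^ 2].  The quadratic form [H ^ 2 * P ^ 2 + Q ^ 2] of the difference of two solutions
    is conserved, hence zero. *)
Lemma flow_arc (a b L : R) (r z u v du dv : R -> R) :
  0 < b < a -> flow (- (1 / (2 * b))) L r z u v du dv ->
  r 0 = a -> u 0 = -1 -> v 0 = 0 ->
  forall x, I01 x ->
    r x = arc_r a b (L / b * x) /\ z x = z 0 + arc_z a b (L / b * x) /\
    u x = cos (arc_th a b (L / b * x)) /\ v x = sin (arc_th a b (L / b * x)).
Proof.
intros hab F hr0 hu0 hv0.
set (w := L / b).
assert (hwb : w * b = L) by (unfold w; field; lra).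
assert (hrv := flow_rv _ _ _ _ _ _ _ _ F hv0). rewrite hr0 in hrv.
assert (FF := F). destruct FF as [f1 f2 f3 f4 f5 f6 f7 f8 f9].
assert (dr := Derive_eq r _ f2). assert (du' := Derive_eq u _ f4).
assert (dar := Derive_eq (arc_r a b) _ (fun t => arc_r_derive a b t hab)).
set (P := fun x => r x ^ 2 - arc_r a b (w * x) ^ 2).
set (Q := fun x => r x * u x - (b * sin (w * x) - a * cos (w * x))).
assert (dP : forall x, is_derive P x (2 * L * Q x)).
{ intros x. unfold P, Q. auto_derive.
  - repeat split; eexists; [apply f2|apply arc_r_derive, hab].
  - rewrite dr, dar, <- arc_cos by exact hab. rewrite <- hwb. ring. }
assert (dQ : forall x, is_derive Q x
  (L * u x ^ 2 + r x * du x - w * (b * cos (w * x) + a * sin (w * x)))).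
{ intros x. unfold Q. auto_derive.
  - repeat split; eexists; [apply f2|apply f4].
  - rewrite dr, du'. ring. }
assert (hE : forall x, I01 x -> (1 / (2 * b)) ^ 2 * P x ^ 2 + Q x ^ 2 = 0).
{ intros x hx.
  rewrite (derive_zero_const01 (fun x => (1 / (2 * b)) ^ 2 * P x ^ 2 + Q x ^ 2)
    (fun x => (1 / (2 * b)) ^ 2 * 2 * P x * (2 * L * Q x) + 2 * Q x *
  (L * u x ^ 2 + r x * du x - w * (b * cos (w * x) + a * sin (w * x))))).
  - unfold P, Q. rewrite hr0, hu0, Rmult_0_r, arc_r_0, cos_0, sin_0 by lra. ring.
  - intros y. auto_derive.
    + repeat split; eexists; [apply dP|apply dQ].
    + rewrite (Derive_eq P _ dP).
      rewrite (Derive_eq Q _ dQ). ring.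
  - intros y hy. assert (hy' : I01 y) by (unfold I01; lra).
    rewrite f8 by exact hy. assert (hp := f6 y hy').
    assert (e : L * u y ^ 2 + r y * (- L * (2 * - (1 / (2 * b)) - v y / r y) * v y)
              = L * (1 - (r y ^ 2 - a ^ 2) / (2 * b ^ 2))).
    { transitivity (L * (u y ^ 2 + v y ^ 2) + L * (r y * v y) / b); [field; lra|].
      rewrite f7, hrv by exact hy'. field. lra. }
    rewrite e. clear e.
    assert (e : w * (b * cos (w * y) + a * sin (w * y))
      = L * (1 - (arc_r a b (w * y) ^ 2 - a ^ 2) / (2 * b ^ 2))).
    { rewrite arc_first_integral, arc_sin by exact hab. rewrite <- hwb. field. lra. }
    rewrite e. unfold P. field. lra.
  - exact hx. }
assert (key : forall x, I01 x -> r x = arc_r a b (w * x) /\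
    u x = cos (arc_th a b (w * x)) /\ v x = sin (arc_th a b (w * x))).
{ intros x hx. assert (e := hE x hx).
  assert (hb : 0 < (1 / (2 * b)) ^ 2) by (apply pow_lt, Rdiv_lt_0_compat; lra).
  assert (hQ : Q x = 0) by nra.
  assert (hP : P x = 0).
  { rewrite hQ in e. assert (P x ^ 2 = 0) by nra. nra. }
  assert (hp := f6 x hx). assert (hq := arc_r_pos a b (w * x) hab).
  assert (er : r x = arc_r a b (w * x)) by (unfold P in hP; nra).
  split; [exact er|split].
  - unfold Q in hQ. rewrite <- arc_cos, <- er in hQ by exact hab. nra.
  - assert (e1 := hrv x hx). assert (e2 := arc_first_integral a b (w * x) hab).
    rewrite <- er in e2. rewrite e2 in e1.
    apply (Rmult_eq_reg_l (r x)); [|lra]. rewrite e1. field. lra. }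
intros x hx. destruct (key x hx) as [k1 [k2 k3]]. repeat split; auto.
assert (hz := derive_zero_const01 (fun x => z x - arc_z a b (w * x))
   (fun x => L * v x - w * (b * sin (arc_th a b (w * x))))).
assert (z x - arc_z a b (w * x) = z 0 - arc_z a b (w * 0)).
{ apply hz; [| |exact hx].
  - intros y. auto_derive.
    + repeat split; eexists; [apply f3|apply arc_z_derive, hab].
    + rewrite (Derive_eq z _ f3).
      rewrite (Derive_eq (arc_z a b) _ (fun t => arc_z_derive a b t hab)).
      ring.
  - intros y hy. destruct (key y) as [_ [_ e]]; [unfold I01; lra|].
    rewrite e, <- hwb. ring. }
rewrite Rmult_0_r, arc_z_0 in H. lra.
Qed.

(** The difference of two lifts of the same angle is a multiple of [2 * PI]; if it were not 0
    at the end, it would pass through [PI] or [- PI]. *)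
Lemma angle_lift (f g : R -> R) :
  (forall x, continuous f x) -> (forall x, continuous g x) -> f 0 = g 0 ->
  (forall x, I01 x -> cos (f x) = cos (g x) /\ sin (f x) = sin (g x)) ->
  f 1 = g 1.
Proof.
intros hf hg h0 hcs. assert (hpi := PI_RGT_0).
assert (h1 : forall x, I01 x -> cos (f x - g x) = 1).
{ intros x hx. destruct (hcs x hx) as [e1 e2].
  rewrite cos_minus, e1, e2. assert (e := sin2_cos2 (g x)). unfold Rsqr in e. lra. }
assert (hc : forall x, continuity_pt (fun x => f x - g x) x).
{ intros x. apply (continuity_pt_minus f g); apply continuity_pt_filterlim; [apply hf|apply
    hg]. }
assert (hno : forall d, Rabs d < 2 * PI -> cos d = 1 -> d = 0).
{ intros d hd e. apply Rabs_def2 in hd.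
  assert (hs : sin (d / 2) = 0).
  { replace d with (2 * (d / 2)) in e by field. rewrite cos_2a_sin in e. nra. }
  destruct (Rtotal_order d 0) as [l|[l|l]]; [|exact l|].
  - assert (0 < sin (- (d / 2))) by (apply sin_gt_0; lra). rewrite sin_neg in H. lra.
  - assert (0 < sin (d / 2)) by (apply sin_gt_0; lra). lra. }
destruct (Rtotal_order (f 1 - g 1) 0) as [l|[l|l]]; [exfalso|lra|exfalso]; clear hcs.
- assert (h2 : f 1 - g 1 <= - (2 * PI)).
  { destruct (Rle_lt_dec (f 1 - g 1) (- (2 * PI))) as [m|m]; [exact m|exfalso].
    assert (f 1 - g 1 = 0); [apply hno; [|apply h1; unfold I01; lra]|lra].
    apply Rabs_def1; lra. }
  destruct (IVT_interv (fun x => - PI - (f x - g x)) 0 1) as [x [hx e]].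
  + intros x _. apply continuity_pt_minus; [apply continuity_pt_const; now intro|apply hc].
  + lra.
  + lra.
  + lra.
  + assert (e1 := h1 x hx). replace (f x - g x) with (- PI) in e1 by lra.
    rewrite cos_neg, cos_PI in e1. lra.
- assert (h2 : 2 * PI <= f 1 - g 1).
  { destruct (Rle_lt_dec (2 * PI) (f 1 - g 1)) as [m|m]; [exact m|exfalso].
    assert (f 1 - g 1 = 0); [apply hno; [|apply h1; unfold I01; lra]|lra].
    apply Rabs_def1; lra. }
  destruct (IVT_interv (fun x => (f x - g x) - PI) 0 1) as [x [hx e]].
  + intros x _. apply continuity_pt_minus; [apply hc|apply continuity_pt_const; now intro].
  + lra.
  + lra.
  + lra.
  + assert (e1 := h1 x hx). replace (f x - g x) with PI in e1 by lra.
    rewrite cos_PI in e1. lra.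
Qed.

(** * Estimates for the height integral *)

Lemma lipschitz_of_derive (f df : R -> R) (K : R) :
  (forall x, is_derive f x (df x)) -> (forall x, Rabs (df x) <= K) ->
  forall x y, Rabs (f x - f y) <= K * Rabs (x - y).
Proof.
intros hd hb x y.
destruct (MVT_gen f y x df) as [c [_ e]].
- intros; apply hd.
- intros z _; apply (is_derive_continuity_pt f z (df z)), hd.
- rewrite e, Rabs_mult. apply Rmult_le_compat_r; [apply Rabs_pos|apply hb].
Qed.

Lemma abs_RInt_le_lip (f : R -> R) (K a b : R) :
  (forall x, continuous f x) -> (forall x, Rabs (f x) <= K) ->
  Rabs (RInt f a b) <= K * Rabs (b - a).
Proof.
intros hc hb.
assert (h := lipschitz_of_derive (RInt f a) f K
  (fun x => RInt_antiderivative f a x hc) hb b a).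
rewrite RInt_point in h. unfold zero in h; simpl in h. now rewrite Rminus_0_r in h.
Qed.

Lemma ex_RInt_cont (f : R -> R) (a b : R) :
  (forall x, continuous f x) -> ex_RInt f a b.
Proof.
intros h. apply (@ex_RInt_continuous R_CompleteNormedModule). intros; apply h.
Qed.

(** The part of the height integral that disappears in the limit of small drops.  It is
    written with [m = b / a], the ratio of the bending radius to the contact radius: this
    form is 1-Lipschitz in [m], uniformly in the angle. *)
Definition tilt_density (m x : R) : R := m * sin x ^ 2 / sqrt (1 + m ^ 2 * sin x ^ 2).
Definition tilt (m y : R) : R := RInt (tilt_density m) y PI.

Lemma tilt_density_continuous (m x : R) : continuous (tilt_density m) x.
Proof.
apply (ex_derive_continuous (tilt_density m)). unfold tilt_density. auto_derive.
assert (h : 0 < 1 + m ^ 2 * sin x ^ 2)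
  by (assert (h1 := pow2_ge_0 m); assert (h2 := pow2_ge_0 (sin x)); nra).
assert (h' := sqrt_lt_R0 _ h). simpl in *.
repeat split; auto; lra.
Qed.

(** The derivative of [m * S / sqrt (1 + m ^ 2 * S)] in [m] is
    [S / (1 + m ^ 2 * S) ^ (3/2)], and [0 <= S <= 1]. *)
Lemma tilt_density_lip (m n x : R) :
  Rabs (tilt_density m x - tilt_density n x) <= Rabs (m - n).
Proof.
rewrite <- (Rmult_1_l (Rabs (m - n))).
set (S := sin x ^ 2).
assert (hS : 0 <= S <= 1).
{ unfold S. assert (h := SIN_bound x). nra. }
apply (lipschitz_of_derive (fun m => tilt_density m x)
  (fun m => S / ((1 + m ^ 2 * S) * sqrt (1 + m ^ 2 * S)))); intros t;
  assert (hq : 1 <= 1 + t ^ 2 * S) by (assert (h := pow2_ge_0 t); nra);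
  assert (hs : 1 <= sqrt (1 + t ^ 2 * S)) by (rewrite <- sqrt_1 at 1; apply sqrt_le_1; lra).
- unfold tilt_density. fold S. auto_derive.
  + simpl in *. repeat split; auto; lra.
  + replace (1 + t * (t * 1) * S) with (1 + t ^ 2 * S) by ring.
    set (q := sqrt (1 + t ^ 2 * S)) in *.
    assert (e : q * q = 1 + t ^ 2 * S) by (apply sqrt_sqrt; lra).
    rewrite <- e. field_simplify; [|lra|lra].
    f_equal. transitivity (S * (q * q - t ^ 2 * S)); [ring|].
    rewrite e. ring.
- rewrite Rabs_pos_eq.
  + apply Rmult_le_reg_r with ((1 + t ^ 2 * S) * sqrt (1 + t ^ 2 * S)); [nra|].
    unfold Rdiv. rewrite Rmult_assoc, Rinv_l by nra. nra.
  + apply Rmult_le_pos; [lra|]. apply Rlt_le, Rinv_0_lt_compat. nra.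
Qed.

Lemma tilt_density_le (m x : R) : Rabs (tilt_density m x) <= Rabs m.
Proof.
assert (h := tilt_density_lip m 0 x). rewrite Rminus_0_r in h.
replace (tilt_density 0 x) with 0 in h by (unfold tilt_density, Rdiv; ring).
now rewrite Rminus_0_r in h.
Qed.

Lemma tilt_lip (m n y z : R) :
  Rabs (tilt m y - tilt n z) <= Rabs (m - n) * Rabs (PI - y) + Rabs n * Rabs (y - z).
Proof.
unfold tilt.
assert (cm := tilt_density_continuous m). assert (cn := tilt_density_continuous n).
assert (e : RInt (tilt_density m) y PI - RInt (tilt_density n) z PI
  = RInt (fun x => tilt_density m x - tilt_density n x) y PI - RInt (tilt_density n) z y).
{ rewrite <- (RInt_Chasles (tilt_density n) z y PI) by (apply ex_RInt_cont; auto).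
  rewrite (RInt_minus (tilt_density m) (tilt_density n)) by (apply ex_RInt_cont; auto).
  unfold minus, plus, opp; simpl. ring. }
rewrite e. apply Rle_trans with (1 := Rabs_triang _ _). rewrite Rabs_Ropp.
apply Rplus_le_compat.
- apply abs_RInt_le_lip; [|intros; apply tilt_density_lip].
  intros x. apply (continuous_minus (tilt_density m) (tilt_density n)); auto.
- apply abs_RInt_le_lip; [exact cn | intros; apply tilt_density_le].
Qed.

Lemma tilt_le (m y : R) : Rabs (tilt m y) <= Rabs m * Rabs (PI - y).
Proof.
apply abs_RInt_le_lip; [apply tilt_density_continuous | intros; apply tilt_density_le].
Qed.

Lemma tilt_continuous (m y : R -> R) (x : R) :
  continuous m x -> continuous y x -> continuous (fun t => tilt (m t) (y t)) x.
Proof.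
intros hm hy.
set (K := fun t => Rabs (m x - m t) * Rabs (PI - y x) + Rabs (m t) * Rabs (y x - y t)).
assert (hK : continuous K x).
{ unfold K.
  apply (continuous_plus (fun t => Rabs (m x - m t) * Rabs (PI - y x))).
  - apply (continuous_mult (fun t => Rabs (m x - m t))); [|apply continuous_const].
    apply (continuous_comp (fun t => m x - m t) Rabs); [|apply continuous_Rabs].
    apply (continuous_minus (fun _ => m x)); [apply continuous_const|exact hm].
  - apply (continuous_mult (fun t => Rabs (m t))).
    + apply (continuous_comp m Rabs); [exact hm|apply continuous_Rabs].
    + apply (continuous_comp (fun t => y x - y t) Rabs); [|apply continuous_Rabs].
      apply (continuous_minus (fun _ => y x)); [apply continuous_const|exact hy]. }
assert (hK0 : K x = 0).
{ unfold K. rewrite !Rminus_diag, Rabs_R0. ring. }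
apply filterlim_locally. intros eps.
assert (h := proj1 (filterlim_locally K (K x)) hK eps).
revert h. apply filter_imp. intros t ht.
rewrite hK0 in ht. unfold ball in *; simpl in *; unfold AbsRing_ball in *; simpl in *.
unfold minus, plus, opp, abs in *; simpl in *.
assert (h1 := tilt_lip (m x) (m t) (y x) (y t)). fold (K t) in h1.
rewrite Rabs_minus_sym in h1. unfold Rminus in h1.
apply Rle_lt_trans with (1 := h1).
apply Rle_lt_trans with (2 := ht). rewrite Ropp_0, Rplus_0_r. apply Rle_abs.
Qed.

Lemma arcsinh_derive (x : R) : is_derive arcsinh x (/ sqrt (x ^ 2 + 1)).
Proof. apply is_derive_Reals, derivable_pt_lim_arcsinh. Qed.

(** Mean value theorem: the slope of [arcsinh] decreases from 1 at the origin. *)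
Lemma arcsinh_bounds (x : R) : 0 <= x -> x / sqrt (x ^ 2 + 1) <= arcsinh x <= x.
Proof.
intros hx.
destruct (MVT_gen arcsinh 0 x (fun x => / sqrt (x ^ 2 + 1))) as [c [hc e]].
- intros; apply arcsinh_derive.
- intros y _; eapply is_derive_continuity_pt, arcsinh_derive.
- rewrite Rmin_left, Rmax_right in hc by lra.
  rewrite arcsinh_0, !Rminus_0_r in e. rewrite e.
  assert (hcc := pow2_ge_0 c).
  assert (hcx : c ^ 2 <= x ^ 2) by (apply pow_incr; lra).
  assert (h1 : 1 <= sqrt (c ^ 2 + 1)) by (rewrite <- sqrt_1 at 1; apply sqrt_le_1; lra).
  assert (h2 : sqrt (c ^ 2 + 1) <= sqrt (x ^ 2 + 1)) by (apply sqrt_le_1; lra).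
  split.
  + unfold Rdiv. rewrite Rmult_comm. apply Rmult_le_compat_r; [lra|].
    apply Rinv_le_contravar; lra.
  + rewrite <- (Rmult_1_l x) at 2. apply Rmult_le_compat_r; [lra|].
    apply Rle_trans with (/ 1); [apply Rinv_le_contravar; lra|lra].
Qed.

Lemma atan_lip (x y : R) : Rabs (atan x - atan y) <= Rabs (x - y).
Proof.
rewrite <- (Rmult_1_l (Rabs (x - y))).
apply (lipschitz_of_derive atan (fun x => / (1 + x ^ 2))); intros t.
- apply is_derive_Reals, derivable_pt_lim_atan.
- assert (h := pow2_ge_0 t).
  rewrite Rabs_pos_eq by (apply Rlt_le, Rinv_0_lt_compat; lra).
  apply Rle_trans with (/ 1); [apply Rinv_le_contravar; lra|lra].
Qed.

(** * Quantities at the triple junction *)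

(** Equals [rbar * sin th2], where [th2] is the initial angle of the outer surface. *)
Definition junction_lift (beta A sg : R) : R := - (A * cos beta + sg * sin beta).
(** Equals [1 - rbar ^ 2]. *)
Definition outer_gap (A sg : R) : R := 1 - A ^ 2 - sg ^ 2.
(** Equals [- 1 / (2 * lam)], the limiting radius of the meridian of a small drop. *)
Definition bend_radius (beta A sg : R) : R := outer_gap A sg / (2 * junction_lift beta A sg).

Lemma rbar_sqr (A sg : R) : rbar A sg ^ 2 = sg ^ 2 + A ^ 2.
Proof. unfold rbar. apply pow2_sqrt. nra. Qed.

Lemma rbar_pos (A sg : R) : 0 < A -> 0 < rbar A sg.
Proof. intros h. apply sqrt_lt_R0. nra. Qed.

Lemma sqrt_rbar (A sg : R) : 0 < A -> sqrt ((sg / A) ^ 2 + 1) = rbar A sg / A.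
Proof.
intros h. apply sqrt_lem_1.
- assert (h' := pow2_ge_0 (sg / A)). lra.
- apply Rlt_le, Rdiv_lt_0_compat; [now apply rbar_pos|exact h].
- transitivity (rbar A sg ^ 2 / A ^ 2); [field; lra|]. rewrite rbar_sqr. field; lra.
Qed.

(** The inverse hyperbolic sine, unlike [arccosh (rbar / A)], is differentiable at [sg = 0]. *)
Lemma zbar_arcsinh (A sg : R) : 0 < A -> 0 <= sg ->
  zbar A sg = A * arcsinh (sg / A).
Proof.
intros h hs. unfold zbar, arccosh, arcsinh. do 2 f_equal.
rewrite sqrt_rbar by exact h.
replace (sqrt ((rbar A sg / A) ^ 2 - 1)) with (sg / A); [ring|].
symmetry. apply sqrt_lem_1.
- replace ((rbar A sg / A) ^ 2 - 1) with ((sg / A) ^ 2).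
  + apply pow2_ge_0.
  + replace ((rbar A sg / A) ^ 2) with (rbar A sg ^ 2 / A ^ 2) by (field; lra).
    rewrite rbar_sqr. field; lra.
- apply Rmult_le_pos; [exact hs|]. apply Rlt_le, Rinv_0_lt_compat, h.
- replace ((rbar A sg / A) ^ 2) with (rbar A sg ^ 2 / A ^ 2) by (field; lra).
  rewrite rbar_sqr. field; lra.
Qed.

Lemma theta3bar_atan (A sg : R) : 0 < A -> 0 <= sg ->
  theta3bar A sg = PI / 2 - atan (sg / A).
Proof.
intros h hs. unfold theta3bar.
rewrite <- (asin_sin (PI / 2 - atan (sg / A))).
- f_equal. rewrite sin_shift, cos_atan.
  replace (1 + (sg / A)²) with ((sg / A) ^ 2 + 1) by (unfold Rsqr; ring).
  rewrite sqrt_rbar by exact h. field. assert (h' := rbar_pos A sg h). lra.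
- assert (b := atan_bound (sg / A)).
  assert (0 <= sg / A) by (apply Rmult_le_pos; [lra|apply Rlt_le, Rinv_0_lt_compat, h]).
  assert (0 <= atan (sg / A)).
  { destruct H as [l|l].
    - rewrite <- atan_0. left. apply atan_increasing, l.
    - rewrite <- l, atan_0. lra. }
  lra.
Qed.

Lemma sin_theta3bar (A sg : R) : 0 < A -> 0 <= sg ->
  sin (theta3bar A sg) = A / rbar A sg.
Proof.
intros h hs. unfold theta3bar. apply sin_asin.
assert (h' := rbar_pos A sg h). assert (e := rbar_sqr A sg).
assert (A <= rbar A sg) by nra.
split.
- assert (0 < A / rbar A sg) by now apply Rdiv_lt_0_compat. lra.
- apply Rmult_le_reg_r with (rbar A sg); [lra|].
  unfold Rdiv. rewrite Rmult_assoc, Rinv_l by lra. lra.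
Qed.

Lemma cos_theta3bar (A sg : R) : 0 < A -> 0 <= sg ->
  cos (theta3bar A sg) = sg / rbar A sg.
Proof.
intros h hs. rewrite theta3bar_atan by assumption.
rewrite cos_shift, sin_atan.
replace (1 + (sg / A)²) with ((sg / A) ^ 2 + 1) by (unfold Rsqr; ring).
rewrite sqrt_rbar by exact h. field. assert (h' := rbar_pos A sg h). lra.
Qed.

(** * Monotonicity of the closing condition *)

(** Small compared with both [- cos beta] and [sin beta], whatever the position of [beta] in
    its interval. *)
Definition eta (beta : R) : R := - cos beta * sin beta / 100.

(** The last inequality puts [A] close to 1; the one before says that the junction does not
    leave the cylinder of radius 1.  Together they bound [sg] by [eta beta]. *)
Definition near (beta A sg : R) : Prop :=
  0 < A < 1 /\ 0 <= sg /\ A ^ 2 + sg ^ 2 <= 1 /\ 1 - A ^ 2 <= eta beta ^ 2.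

Lemma beta_signs (beta : R) : PI / 2 < beta < PI ->
  -1 < cos beta < 0 /\ 0 < sin beta < 1 /\ cos beta ^ 2 + sin beta ^ 2 = 1.
Proof.
intros h. assert (hpi := PI_RGT_0).
assert (hs : 0 < sin beta) by (apply sin_gt_0; lra).
assert (hc : cos beta < 0) by (apply cos_lt_0; lra).
assert (e := sin2_cos2 beta). unfold Rsqr in e. nra.
Qed.

Lemma eta_bounds (beta : R) : PI / 2 < beta < PI ->
  0 < eta beta /\ eta beta <= - cos beta / 100 /\ eta beta <= sin beta / 100.
Proof.
intros h. destruct (beta_signs beta h) as [hc [hs _]]. unfold eta. nra.
Qed.

Lemma near_bounds (beta A sg : R) : PI / 2 < beta < PI -> near beta A sg ->
  99 / 100 <= A /\ sg <= eta beta /\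
  98 / 100 * - cos beta <= junction_lift beta A sg <= - cos beta /\
  0 <= outer_gap A sg <= eta beta ^ 2 /\
  A * cos beta - sg * sin beta < 0 /\
  0 < A * sin beta + sg * cos beta.
Proof.
intros hb [hA [hs [h1 h2]]].
destruct (beta_signs beta hb) as [hc [hsn hcs]].
destruct (eta_bounds beta hb) as [e0 [e1 e2]].
set (c := cos beta) in *. set (s := sin beta) in *. set (e := eta beta) in *.
assert (hA' : 99 / 100 <= A) by nra.
assert (hsg : sg <= e) by nra.
assert (hsg' : 0 <= sg * s <= - c / 100) by nra.
assert (hsg'' : 0 <= sg * - c <= s / 100) by nra.
unfold junction_lift, outer_gap. fold c s. repeat split; nra.
Qed.

Lemma bend_radius_bounds (beta A sg : R) : PI / 2 < beta < PI -> near beta A sg ->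
  0 <= bend_radius beta A sg <= eta beta / 100.
Proof.
intros hb hn. destruct (near_bounds beta A sg hb hn) as [h1 [h2 [h3 [h4 _]]]].
destruct (beta_signs beta hb) as [hc [hsn hcs]].
destruct (eta_bounds beta hb) as [e0 [e1 e2]].
unfold bend_radius. split.
- apply Rmult_le_pos; [lra|]. apply Rlt_le, Rinv_0_lt_compat. lra.
- apply Rmult_le_reg_r with (2 * junction_lift beta A sg); [lra|].
  unfold Rdiv at 1. rewrite Rmult_assoc, Rinv_l by lra. nra.
Qed.

(** Equals [a_ell ^ 2]. *)
Definition inner_radius2 (beta A sg : R) : R := 1 + 4 * A * cos beta * bend_radius beta A sg.

Lemma inner_radius2_bounds (beta A sg : R) : PI / 2 < beta < PI -> near beta A sg ->
  81 / 100 <= inner_radius2 beta A sg <= 1.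
Proof.
intros hb hn. assert (h := bend_radius_bounds beta A sg hb hn).
destruct (beta_signs beta hb) as [hc [hsn hcs]].
destruct (eta_bounds beta hb) as [e0 [e1 e2]].
destruct hn as [hA _]. unfold inner_radius2.
assert (0 <= - cos beta * bend_radius beta A sg <= 1 / 100) by nra. nra.
Qed.

(** Equals the ratio of [bend_radius] to [a_ell], the argument of [tilt]. *)
Definition aspect (beta A sg : R) : R := bend_radius beta A sg / sqrt (inner_radius2 beta A sg).

Lemma sqrt_inner_radius2_bounds (beta A sg : R) : PI / 2 < beta < PI -> near beta A sg ->
  9 / 10 <= sqrt (inner_radius2 beta A sg) <= 1.
Proof.
intros hb hn. assert (h := inner_radius2_bounds beta A sg hb hn).
split.
- rewrite <- (sqrt_pow2 (9 / 10)) by lra. apply sqrt_le_1; lra.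
- rewrite <- sqrt_1. apply sqrt_le_1; lra.
Qed.

Lemma aspect_bounds (beta A sg : R) : PI / 2 < beta < PI -> near beta A sg ->
  0 <= aspect beta A sg <= eta beta / 50.
Proof.
intros hb hn. assert (h := sqrt_inner_radius2_bounds beta A sg hb hn).
assert (h' := bend_radius_bounds beta A sg hb hn). unfold aspect. split.
- apply Rmult_le_pos; [lra|]. apply Rlt_le, Rinv_0_lt_compat. lra.
- apply Rmult_le_reg_r with (sqrt (inner_radius2 beta A sg)); [lra|].
  unfold Rdiv at 1. rewrite Rmult_assoc, Rinv_l by lra. nra.
Qed.

(** Up to the positive factor [2 * n * n'], the difference of the two fractions is
    [(sg - tau) * (- (sg + tau) * n' + sin beta * outer_gap A tau)], which is small because
    [sg + tau] and the gap are. *)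
Lemma bend_radius_lip (beta A sg tau : R) : PI / 2 < beta < PI ->
  near beta A sg -> near beta A tau ->
  Rabs (bend_radius beta A sg - bend_radius beta A tau) * cos beta ^ 2
  <= 2 * eta beta * Rabs (sg - tau).
Proof.
intros hb hn hm.
destruct (near_bounds beta A sg hb hn) as [h1 [h2 [h3 [h4 _]]]].
destruct (near_bounds beta A tau hb hm) as [_ [g2 [g3 [g4 _]]]].
destruct (beta_signs beta hb) as [hc [hsn hcs]].
destruct (eta_bounds beta hb) as [e0 [e1 e2]].
destruct hn as [_ [h5 _]]. destruct hm as [_ [g5 _]].
set (n := junction_lift beta A sg) in *. set (n' := junction_lift beta A tau) in *.
set (N := (sg - tau) * (- (sg + tau) * n' + sin beta * outer_gap A tau)).
assert (e : bend_radius beta A sg - bend_radius beta A tau = N / (2 * n * n')).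
{ unfold bend_radius. fold n n'.
  transitivity ((outer_gap A sg * n' - outer_gap A tau * n) / (2 * n * n')); [field; lra|].
  f_equal. unfold N, n, n', outer_gap, junction_lift. ring. }
assert (hN : Rabs N <= 3 * eta beta * Rabs (sg - tau)).
{ unfold N. rewrite Rabs_mult, Rmult_comm. apply Rmult_le_compat_r; [apply Rabs_pos|].
  assert (hx : 0 <= (sg + tau) * n' <= 2 * eta beta) by nra.
  assert (hy : 0 <= sin beta * outer_gap A tau <= eta beta) by nra.
  apply Rabs_le. lra. }
rewrite e. unfold Rdiv. rewrite Rabs_mult.
assert (hnn : cos beta ^ 2 * (19 / 10) <= 2 * n * n') by nra.
assert (hp : 0 < 2 * n * n') by nra.
rewrite Rabs_inv, (Rabs_pos_eq (2 * n * n')) by lra.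
apply Rmult_le_reg_r with (2 * n * n'); [exact hp|].
replace (Rabs N * / (2 * n * n') * cos beta ^ 2 * (2 * n * n'))
  with (Rabs N * cos beta ^ 2) by (field; lra).
assert (hc2 : 0 < cos beta ^ 2) by nra.
apply Rle_trans with (3 * eta beta * Rabs (sg - tau) * cos beta ^ 2).
- apply Rmult_le_compat_r; lra.
- assert (hz : 0 <= eta beta * Rabs (sg - tau))
    by (apply Rmult_le_pos; [lra|apply Rabs_pos]). nra.
Qed.

Lemma aspect_lip (beta A sg tau : R) : PI / 2 < beta < PI ->
  near beta A sg -> near beta A tau ->
  Rabs (aspect beta A sg - aspect beta A tau) <= 2 * Rabs (bend_radius beta A sg -
    bend_radius beta A tau).
Proof.
intros hb hn hm.
destruct (beta_signs beta hb) as [hc _].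
assert (e0 := proj1 (eta_bounds beta hb)).
assert (e1 := proj2 (proj2 (eta_bounds beta hb))).
assert (hs := proj1 (proj2 (beta_signs beta hb))).
assert (s1 := sqrt_inner_radius2_bounds beta A sg hb hn).
assert (s2 := sqrt_inner_radius2_bounds beta A tau hb hm).
assert (b2 := bend_radius_bounds beta A tau hb hm).
assert (a1 := inner_radius2_bounds beta A sg hb hn). assert (a2 := inner_radius2_bounds
  beta A tau hb hm).
assert (q1 : sqrt (inner_radius2 beta A sg) ^ 2 = inner_radius2 beta A sg) by (apply
  pow2_sqrt; lra).
assert (q2 : sqrt (inner_radius2 beta A tau) ^ 2 = inner_radius2 beta A tau) by (apply
  pow2_sqrt; lra).
unfold aspect. set (w := sqrt (inner_radius2 beta A sg)) in *. set (w' := sqrt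
  (inner_radius2 beta A tau)) in *.
set (x := bend_radius beta A sg) in *. set (y := bend_radius beta A tau) in *.
assert (e : x / w - y / w' = (x - y) * (1 / w - 4 * A * cos beta * y / ((w + w') * w * w'))).
{ assert (e' : w' - w = - 4 * A * cos beta * (x - y) / (w + w')).
  { apply (Rmult_eq_reg_r (w + w')); [|lra].
    transitivity (w' ^ 2 - w ^ 2); [ring|]. rewrite q1, q2. unfold inner_radius2.
    fold x y. field. lra. }
  transitivity ((x - y) / w + y * (w' - w) / (w * w')); [field; lra|].
  rewrite e'. field. lra. }
rewrite e, Rabs_mult, Rmult_comm. apply Rmult_le_compat_r; [apply Rabs_pos|].
destruct hn as [hA _].
assert (0 < / w <= 10 / 9).
{ split; [apply Rinv_0_lt_compat; lra|].
  apply Rmult_le_reg_r with w; [lra|]. rewrite Rinv_l by lra. lra. }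
assert (hW : 1 <= (w + w') * w * w') by nra.
assert (hv : 0 < / ((w + w') * w * w') <= 1).
{ split; [apply Rinv_0_lt_compat; lra|].
  apply Rmult_le_reg_r with ((w + w') * w * w'); [lra|]. rewrite Rinv_l by lra. lra. }
unfold Rdiv. set (v := / ((w + w') * w * w')) in *.
assert (hz : 0 <= 4 * A * - cos beta * y <= 4 / 10).
{ assert (0 <= A * - cos beta <= 1) by nra. nra. }
rewrite Rabs_pos_eq; nra.
Qed.

(** Equals [theta1bar], in a form smooth at [sg = 0]. *)
Definition junction_angle (beta A sg : R) : R := PI / 2 - atan (sg / A) - beta.

Lemma theta1bar_junction_angle (beta A sg : R) : 0 < A -> 0 <= sg ->
  theta1bar A sg beta = junction_angle beta A sg.
Proof.
intros hA hs. unfold theta1bar, junction_angle. now rewrite theta3bar_atan.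
Qed.

Lemma junction_angle_far (beta A sg : R) : PI / 2 < beta < PI ->
  Rabs (PI - junction_angle beta A sg) <= 8.
Proof.
intros h. unfold junction_angle. assert (b := atan_bound (sg / A)).
assert (p := PI_4). apply Rabs_le. lra.
Qed.

Lemma junction_angle_lip (beta A sg tau : R) : 99 / 100 <= A ->
  Rabs (junction_angle beta A sg - junction_angle beta A tau) <= 2 * Rabs (sg - tau).
Proof.
intros h. unfold junction_angle.
replace (PI / 2 - atan (sg / A) - beta - (PI / 2 - atan (tau / A) - beta))
  with (atan (tau / A) - atan (sg / A)) by ring.
apply Rle_trans with (1 := atan_lip _ _).
replace (tau / A - sg / A) with ((tau - sg) * / A) by (field; lra).
rewrite Rabs_mult, Rabs_minus_sym.
assert (0 < / A <= 2).
{ split; [apply Rinv_0_lt_compat; lra|].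
  apply Rmult_le_reg_r with A; [lra|]. rewrite Rinv_l by lra. lra. }
rewrite (Rabs_pos_eq (/ A)) by lra. assert (p := Rabs_pos (sg - tau)). nra.
Qed.

(** The product of [2 * junction_lift] and [z1 A sg beta PI] is the sum of this main part and of
    [closing_pert].  The factor clears the large curvature [lam] and leaves a function close to
    [- 2 * cos beta * sg] minus a multiple of the gap, whose derivative in [sg] stays away
    from 0. *)
Definition closing_main (beta A sg : R) : R :=
  2 * junction_lift beta A sg * (A * arcsinh (sg / A))
  - outer_gap A sg * (1 + (A * sin beta + sg * cos beta) / sqrt (sg ^ 2 + A ^ 2)).
Definition closing_pert (beta A sg : R) : R :=
  outer_gap A sg * tilt (aspect beta A sg) (junction_angle beta A sg).
Definition closing (beta A sg : R) : R := closing_main beta A sg + closing_pert beta A sg.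

(** Both factors of the perturbation are small, so in the variation of the product the Lipschitz
    constant of each factor is multiplied by a small number. *)
Lemma closing_pert_lip (beta A sg tau : R) : PI / 2 < beta < PI ->
  near beta A sg -> near beta A tau ->
  Rabs (closing_pert beta A sg - closing_pert beta A tau) <= - cos beta / 2 * Rabs (sg - tau).
Proof.
intros hb hn hm.
destruct (near_bounds beta A sg hb hn) as [h1 [h2 [h3 [h4 _]]]].
destruct (near_bounds beta A tau hb hm) as [_ [g2 [g3 [g4 _]]]].
destruct (beta_signs beta hb) as [hc [hsn hcs]].
destruct (eta_bounds beta hb) as [e0 [e1 e2]].
assert (l1 := bend_radius_lip beta A sg tau hb hn hm).
assert (l2 := aspect_lip beta A sg tau hb hn hm).
assert (l3 := junction_angle_lip beta A sg tau h1).
assert (m2 := aspect_bounds beta A tau hb hm).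
assert (t1 := tilt_lip (aspect beta A sg) (aspect beta A tau) (junction_angle beta A sg)
  (junction_angle beta A tau)).
assert (t2 := tilt_le (aspect beta A tau) (junction_angle beta A tau)).
assert (f1 := junction_angle_far beta A sg hb). assert (f2 := junction_angle_far beta A tau hb).
rewrite (Rabs_pos_eq (aspect beta A tau)) in * by lra.
destruct hn as [_ [h5 _]]. destruct hm as [_ [g5 _]].
assert (ld : Rabs (outer_gap A sg - outer_gap A tau) <= 2 * eta beta * Rabs (sg - tau)).
{ replace (outer_gap A sg - outer_gap A tau) with (- (sg + tau) * (sg - tau)) by (unfold
    outer_gap; ring).
  rewrite Rabs_mult, Rabs_Ropp, Rabs_pos_eq by lra.
  apply Rmult_le_compat_r; [apply Rabs_pos|lra]. }
unfold closing_pert.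
set (T := tilt (aspect beta A sg) (junction_angle beta A sg)) in *.
set (T' := tilt (aspect beta A tau) (junction_angle beta A tau)) in *.
set (D := Rabs (sg - tau)) in *. assert (hD : 0 <= D) by apply Rabs_pos.
replace (outer_gap A sg * T - outer_gap A tau * T')
  with (outer_gap A sg * (T - T') + (outer_gap A sg - outer_gap A tau) * T') by ring.
apply Rle_trans with (1 := Rabs_triang _ _). rewrite !Rabs_mult.
rewrite (Rabs_pos_eq (outer_gap A sg)) by lra.
set (B := Rabs (bend_radius beta A sg - bend_radius beta A tau)) in *.
assert (hB : 0 <= B) by apply Rabs_pos.
set (e := eta beta) in *. set (c := cos beta) in *.
assert (t2' : Rabs T' <= e / 5).
{ apply Rle_trans with (1 := t2). assert (p := Rabs_pos (PI - junction_angle beta A tau)).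
    nra. }
assert (t1' : Rabs (T - T') <= 16 * B + e / 25 * D).
{ apply Rle_trans with (1 := t1).
  assert (p := Rabs_pos (PI - junction_angle beta A sg)).
  assert (p' := Rabs_pos (aspect beta A sg - aspect beta A tau)).
  assert (p'' := Rabs_pos (junction_angle beta A sg - junction_angle beta A tau)).
  apply Rplus_le_compat; nra. }
assert (x1 : outer_gap A sg * Rabs (T - T') <= e ^ 2 * (16 * B + e / 25 * D)).
{ apply Rmult_le_compat; try lra. apply Rabs_pos. }
assert (x2 : Rabs (outer_gap A sg - outer_gap A tau) * Rabs T' <= 2 * e * D * (e / 5)).
{ apply Rmult_le_compat; try lra; apply Rabs_pos. }
assert (ee : e ^ 2 <= c ^ 2 / 10000) by nra.
assert (x3 : e ^ 2 * B <= e / 5000 * D).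
{ apply Rle_trans with (c ^ 2 / 10000 * B); [apply Rmult_le_compat_r; lra|]. nra. }
assert (hc1 : 0 <= e <= 1 / 100) by lra.
assert (x4 : e * D <= - c / 100 * D) by (apply Rmult_le_compat_r; lra).
assert (x5 : 0 <= e * D) by (apply Rmult_le_pos; lra).
assert (x6 : e * (e * D) <= e * D) by nra.
assert (x7 : e * (e * (e * D)) <= e * D) by nra.
nra.
Qed.

Lemma closing_main_derive (beta A sg : R) : 0 < A ->
  is_derive (closing_main beta A) sg
   (- 2 * sin beta * (A * arcsinh (sg / A)) + 2 * junction_lift beta A sg * (A / rbar A sg)
    + 2 * sg * (1 + (A * sin beta + sg * cos beta) / rbar A sg)
    + outer_gap A sg * (- cos beta / rbar A sg
                 + (A * sin beta + sg * cos beta) * sg / rbar A sg ^ 3)).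
Proof.
intros hA. assert (hr := rbar_pos A sg hA). assert (hr2 := rbar_sqr A sg).
assert (hq := sqrt_rbar A sg hA).
assert (hp : 0 < sg ^ 2 + A ^ 2) by nra.
unfold closing_main, junction_lift, outer_gap. auto_derive.
- split; [eexists; apply arcsinh_derive|].
  split; [apply Rlt_le_trans with (1 := hp); right; ring|].
  split; [|exact I].
  replace (sg * (sg * 1) + A * (A * 1)) with (sg ^ 2 + A ^ 2) by ring.
  fold (rbar A sg). lra.
- rewrite (Derive_eq arcsinh _ arcsinh_derive).
  replace (sqrt ((sg * / A) ^ 2 + 1)) with (rbar A sg / A)
    by (rewrite <- hq; reflexivity).
  replace (sqrt (sg * (sg * 1) + A * (A * 1))) with (rbar A sg)
    by (unfold rbar; f_equal; ring).
  set (r := rbar A sg) in *. unfold Rdiv. field. lra.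
Qed.

(** Of the four terms of the derivative, [2 * junction_lift * (A / rbar)] is almost
    [- 2 * cos beta]; the first one is negligible and the other two are nonnegative. *)
Lemma closing_main_incr (beta A sg tau : R) : PI / 2 < beta < PI ->
  near beta A sg -> near beta A tau -> sg < tau ->
  - cos beta * (tau - sg) <= closing_main beta A tau - closing_main beta A sg.
Proof.
intros hb hn hm hlt. assert (hA := proj1 hn).
destruct (MVT_cor2 (closing_main beta A) _ sg tau hlt
  (fun x _ => proj1 (is_derive_Reals _ _ _) (closing_main_derive beta A x (proj1 hA))))
  as [x [e hx]].
rewrite e. apply Rmult_le_compat_r; [lra|]. clear e.
assert (hnx : near beta A x).
{ destruct hn as [_ [h1 [h2 h3]]], hm as [_ [g1 [g2 g3]]].
  repeat split; try lra. nra. }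
destruct (near_bounds beta A x hb hnx) as [h1 [h2 [h3 [h4 [h5 h6]]]]].
destruct (beta_signs beta hb) as [hc [hsn hcs]].
destruct (eta_bounds beta hb) as [e0 [e1 e2]].
assert (hr := rbar_pos A x (proj1 hA)). assert (hr2 := rbar_sqr A x).
destruct hnx as [_ [k1 [k2 _]]].
assert (hr1 : rbar A x <= 1) by nra.
assert (hir : 1 <= / rbar A x).
{ rewrite <- Rinv_1 at 1. apply Rinv_le_contravar; lra. }
assert (ha : A * arcsinh (x / A) <= x).
{ assert (hx0 : 0 <= x / A)
    by (apply Rmult_le_pos; [lra|apply Rlt_le, Rinv_0_lt_compat; lra]).
  destruct (arcsinh_bounds (x / A) hx0) as [_ h].
  apply Rmult_le_compat_l with (r := A) in h; [|lra].
  replace (A * (x / A)) with x in h by (field; lra). exact h. }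
assert (p1 : 0 <= x * (1 + (A * sin beta + x * cos beta) / rbar A x)).
{ apply Rmult_le_pos; [lra|]. unfold Rdiv. nra. }
assert (p2 : 0 <= outer_gap A x * (- cos beta / rbar A x
              + (A * sin beta + x * cos beta) * x / rbar A x ^ 3)).
{ apply Rmult_le_pos; [lra|].
  assert (0 <= - cos beta / rbar A x) by (unfold Rdiv; nra).
  assert (0 <= (A * sin beta + x * cos beta) * x / rbar A x ^ 3).
  { apply Rmult_le_pos; [nra|]. apply Rlt_le, Rinv_0_lt_compat, pow_lt, hr. }
  lra. }
assert (p3 : 98 / 100 * - cos beta * (99 / 100) <= junction_lift beta A x * (A / rbar A x)).
{ apply Rmult_le_compat; try lra. unfold Rdiv. nra. }
assert (p4 : sin beta * (A * arcsinh (x / A)) <= - cos beta / 100) by nra.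
lra.
Qed.

(** The increase of the main part dominates the variation of the perturbation. *)
Lemma closing_incr (beta A sg tau : R) : PI / 2 < beta < PI ->
  near beta A sg -> near beta A tau -> sg < tau -> closing beta A sg < closing beta A tau.
Proof.
intros hb hn hm hlt.
assert (h1 := closing_main_incr beta A sg tau hb hn hm hlt).
assert (h2 := closing_pert_lip beta A sg tau hb hn hm).
assert (h3 := proj1 (beta_signs beta hb)).
apply Rabs_le_between in h2.
rewrite Rabs_left in h2 by lra. unfold closing. nra.
Qed.

(** * Solving the closing condition *)

Lemma a_ell_eq (beta A sg : R) : junction_lift beta A sg <> 0 ->
  a_ell A sg beta = sqrt (inner_radius2 beta A sg).
Proof.
intros h. unfold a_ell, inner_radius2, bend_radius. f_equal. unfold junction_lift,
  outer_gap in *. field. lra.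
Qed.

Lemma lam_eq (beta A sg : R) : junction_lift beta A sg <> 0 -> outer_gap A sg <> 0 ->
  lam A sg beta = - (1 / (2 * bend_radius beta A sg)).
Proof. intros h1 h2. unfold lam, bend_radius. unfold junction_lift, outer_gap in *. field.
  lra. Qed.

Lemma z1_height (beta A sg : R) : junction_lift beta A sg <> 0 -> 0 < bend_radius beta A sg ->
  outer_gap A sg <> 0 -> 0 < inner_radius2 beta A sg ->
  z1 A sg beta PI = zbar A sg - bend_radius beta A sg *
    RInt (height_density (sqrt (inner_radius2 beta A sg) / bend_radius beta A sg))
      (theta1bar A sg beta) PI.
Proof.
intros h1 h2 h3 h4. unfold z1. rewrite lam_eq, a_ell_eq by assumption.
set (b := bend_radius beta A sg) in *. set (a := sqrt (inner_radius2 beta A sg)).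
assert (ha : 0 < a) by now apply sqrt_lt_R0.
assert (hq : 0 < a / b) by now apply Rdiv_lt_0_compat.
rewrite (RInt_ext _ (fun x => opp (height_density (a / b) x))).
- rewrite (RInt_opp (height_density (a / b)))
    by (apply ex_RInt_cont; intros; now apply height_density_continuous).
  unfold opp; simpl. field. lra.
- intros x _. change (opp (height_density (a / b) x)) with (- height_density (a / b) x).
  unfold height_density.
  replace (4 * (- (1 / (2 * b))) ^ 2 * a ^ 2) with ((a / b) ^ 2) by (field; lra).
  match goal with |- @eq _ ?y ?z => change (@eq R y z) end. ring.
Qed.

(** Splits off the integral of [sin], the height of an arc of the unit circle between the
    tangent angles [PI] and [y]. *)
Lemma RInt_height_density (a b y : R) : 0 < a -> 0 < b ->
  RInt (height_density (a / b)) y PI = 1 + cos y - tilt (b / a) y.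
Proof.
intros ha hb. unfold tilt.
assert (e : RInt sin y PI = 1 + cos y).
{ apply (@is_RInt_unique R_CompleteNormedModule).
  replace (1 + cos y) with (minus (- cos PI) (- cos y))
    by (unfold minus, plus, opp; simpl; rewrite cos_PI; ring).
  apply (is_RInt_derive (fun x => - cos x)).
  - intros x _. auto_derive; [exact I|ring].
  - intros x _. apply continuity_pt_filterlim, continuity_sin. }
rewrite <- e. rewrite <- (RInt_minus sin (tilt_density (b / a))).
- apply RInt_ext. intros x _. unfold height_density, tilt_density, minus, plus, opp; simpl.
  unfold Rminus. do 2 f_equal.
  set (S := sin x * (sin x * 1)).
  assert (hS : 0 <= S) by (unfold S; nra).
  assert (hab : 0 < b / a) by now apply Rdiv_lt_0_compat.
  replace (1 + b / a * (b / a * 1) * S) with ((b / a) ^ 2 * (S + a / b * (a / b * 1)))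
    by (field; lra).
  assert (0 < a / b * (a / b * 1)).
  { assert (0 < a / b) by now apply Rdiv_lt_0_compat. nra. }
  rewrite sqrt_mult, sqrt_pow2 by nra.
  assert (0 < sqrt (S + a / b * (a / b * 1))) by (apply sqrt_lt_R0; lra).
  field. repeat split; lra.
- apply ex_RInt_cont. intros; apply continuity_pt_filterlim, continuity_sin.
- apply ex_RInt_cont, tilt_density_continuous.
Qed.

Lemma cos_theta1bar (beta A sg : R) : 0 < A -> 0 <= sg ->
  cos (theta1bar A sg beta) = (A * sin beta + sg * cos beta) / rbar A sg.
Proof.
intros h hs. unfold theta1bar.
rewrite cos_minus, cos_theta3bar, sin_theta3bar by assumption.
field. assert (h' := rbar_pos A sg h). lra.
Qed.

Lemma z1_closing (beta A sg : R) : PI / 2 < beta < PI -> near beta A sg ->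
  0 < outer_gap A sg -> 2 * junction_lift beta A sg * z1 A sg beta PI = closing beta A sg.
Proof.
intros hb hn hd.
destruct (near_bounds beta A sg hb hn) as [h1 [h2 [h3 [h4 [h5 h6]]]]].
destruct (beta_signs beta hb) as [hc _].
assert (ha := inner_radius2_bounds beta A sg hb hn).
destruct hn as [hA [hs _]].
assert (hbb : 0 < bend_radius beta A sg) by (apply Rdiv_lt_0_compat; lra).
rewrite z1_height by lra.
rewrite RInt_height_density by (try apply sqrt_lt_R0; lra).
rewrite cos_theta1bar, zbar_arcsinh, theta1bar_junction_angle by lra.
fold (aspect beta A sg).
unfold closing, closing_main, closing_pert. fold (rbar A sg).
unfold bend_radius. field. assert (h' := rbar_pos A sg (proj1 hA)). lra.
Qed.

Lemma closing_continuous_sg (beta A sg : R) : PI / 2 < beta < PI -> near beta A sg ->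
  continuous (closing beta A) sg.
Proof.
intros hb hn.
destruct (near_bounds beta A sg hb hn) as [h1 [h2 [h3 [h4 [h5 h6]]]]].
destruct (beta_signs beta hb) as [hc _].
assert (ha := inner_radius2_bounds beta A sg hb hn).
assert (hs := sqrt_inner_radius2_bounds beta A sg hb hn).
apply (continuous_plus (closing_main beta A)).
- apply (ex_derive_continuous (closing_main beta A)). eexists. apply closing_main_derive, hn.
- apply (continuous_mult (outer_gap A)).
  + apply (ex_derive_continuous (outer_gap A)). unfold outer_gap. auto_derive. exact I.
  + apply tilt_continuous.
    * apply (ex_derive_continuous (aspect beta A)).
      unfold inner_radius2, bend_radius, junction_lift, outer_gap in *. unfold aspect,
        inner_radius2, bend_radius, junction_lift, outer_gap. auto_derive.
      simpl in *; unfold Rdiv, Rminus in *. repeat split; lra.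
    * apply (ex_derive_continuous (junction_angle beta A)). unfold junction_angle.
        auto_derive. exact I.
Qed.

Lemma closing_continuous_A (beta A sg : R) : PI / 2 < beta < PI -> near beta A sg ->
  continuous (fun t => closing beta t sg) A.
Proof.
intros hb hn.
destruct (near_bounds beta A sg hb hn) as [h1 [h2 [h3 [h4 [h5 h6]]]]].
destruct (beta_signs beta hb) as [hc _].
assert (ha := inner_radius2_bounds beta A sg hb hn).
assert (hs := sqrt_inner_radius2_bounds beta A sg hb hn).
apply (continuous_plus (fun t => closing_main beta t sg)).
- apply (ex_derive_continuous (fun t => closing_main beta t sg)).
  unfold closing_main, junction_lift, outer_gap. auto_derive.
  assert (hp : 0 < sg * (sg * 1) + A * (A * 1)) by nra.
  assert (hq := sqrt_lt_R0 _ hp).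
  repeat split; try lra. eexists; apply arcsinh_derive.
- apply (continuous_mult (fun t => outer_gap t sg)).
  + apply (ex_derive_continuous (fun t => outer_gap t sg)). unfold outer_gap. auto_derive.
      exact I.
  + apply (tilt_continuous (fun t => aspect beta t sg) (fun t => junction_angle beta t sg)).
    * apply (ex_derive_continuous (fun t => aspect beta t sg)).
      unfold inner_radius2, bend_radius, junction_lift, outer_gap in *. unfold aspect,
        inner_radius2, bend_radius, junction_lift, outer_gap. auto_derive.
      simpl in *; unfold Rdiv, Rminus in *. repeat split; lra.
    * apply (ex_derive_continuous (fun t => junction_angle beta t sg)). unfold
        junction_angle. auto_derive. lra.
Qed.

(** At [sg = 0] the catenoid has no height, so the drop is too high.  At
    [sg ^ 2 = (1 - A ^ 2) / 2] the height [zbar] is of order [sg], which exceeds the height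
    of the drop, of order [sg ^ 2].  The bound on the root also makes the contact circle of
    the drop smaller than that of the grain boundary. *)
Lemma closing_root (beta A : R) : PI / 2 < beta < PI ->
  0 < A < 1 -> 1 - A ^ 2 <= eta beta ^ 2 ->
  exists sg, 0 < sg /\ 2 * sg ^ 2 < 1 - A ^ 2 /\ closing beta A sg = 0.
Proof.
intros hb hA he.
destruct (beta_signs beta hb) as [hc [hsn hcs]].
destruct (eta_bounds beta hb) as [e0 [e1 e2]].
set (T := sqrt ((1 - A ^ 2) / 2)).
assert (hT0 : 0 < (1 - A ^ 2) / 2) by nra.
assert (hT : 0 < T) by now apply sqrt_lt_R0.
assert (hT2 : T ^ 2 = (1 - A ^ 2) / 2) by (apply pow2_sqrt; lra).
assert (hnear : forall x, 0 <= x <= T -> near beta A x).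
{ intros x hx. repeat split; try lra. nra. }
assert (hpert : forall x, 0 <= x <= T -> Rabs (closing_pert beta A x) <= outer_gap A x * (1
  / 10)).
{ intros x hx. assert (hn := hnear x hx).
  destruct (near_bounds beta A x hb hn) as [_ [_ [_ [h4 _]]]].
  assert (hm := aspect_bounds beta A x hb hn).
  unfold closing_pert. rewrite Rabs_mult, (Rabs_pos_eq (outer_gap A x)) by lra.
  apply Rmult_le_compat_l; [lra|].
  apply Rle_trans with (1 := tilt_le _ _).
  rewrite Rabs_pos_eq by lra.
  assert (f := junction_angle_far beta A x hb). assert (p := Rabs_pos (PI - junction_angle
    beta A x)). nra. }
assert (hneg : closing beta A 0 < 0).
{ assert (h := hpert 0 ltac:(lra)). apply Rabs_le_between in h.
  assert (hd : outer_gap A 0 = 1 - A ^ 2) by (unfold outer_gap; ring).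
  assert (closing_main beta A 0 = - outer_gap A 0 * (1 + sin beta)).
  { unfold closing_main. replace (0 / A) with 0 by (unfold Rdiv; ring). rewrite arcsinh_0.
    replace (sqrt (0 ^ 2 + A ^ 2)) with A.
    - field. lra.
    - replace (0 ^ 2 + A ^ 2) with (A ^ 2) by ring. symmetry; apply sqrt_pow2; lra. }
  unfold closing. nra. }
assert (hpos : 0 < closing beta A T).
{ assert (h := hpert T ltac:(lra)). apply Rabs_le_between in h.
  assert (hn := hnear T ltac:(lra)).
  destruct (near_bounds beta A T hb hn) as [h1 [h2 [h3 [h4 [h5 h6]]]]].
  assert (hd : outer_gap A T = T ^ 2) by (unfold outer_gap; lra).
  assert (hr := rbar_pos A T (proj1 hA)). assert (hr2 := rbar_sqr A T).
  assert (hx0 : 0 <= T / A)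
    by (apply Rmult_le_pos; [lra|apply Rlt_le, Rinv_0_lt_compat; lra]).
  destruct (arcsinh_bounds (T / A) hx0) as [g _].
  rewrite sqrt_rbar in g by lra.
  replace (T / A / (rbar A T / A)) with (T / rbar A T) in g by (field; lra).
  assert (hr1 : A <= rbar A T <= 1) by nra.
  assert (g' : T <= arcsinh (T / A)).
  { apply Rle_trans with (2 := g). apply Rmult_le_reg_r with (rbar A T); [lra|].
    unfold Rdiv. rewrite Rmult_assoc, Rinv_l by lra. nra. }
  assert (g2 : (A * sin beta + T * cos beta) / sqrt (T ^ 2 + A ^ 2) <= 1).
  { fold (rbar A T). apply Rmult_le_reg_r with (rbar A T); [lra|].
    unfold Rdiv. rewrite Rmult_assoc, Rinv_l by lra. nra. }
  assert (g3 : 98 / 100 * - cos beta * (99 / 100 * T)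
               <= junction_lift beta A T * (A * arcsinh (T / A))).
  { apply Rmult_le_compat; try nra. }
  unfold closing, closing_main. rewrite hd in *.
  assert (g4 : T ^ 2 * (1 + (A * sin beta + T * cos beta) / sqrt (T ^ 2 + A ^ 2))
    <= T ^ 2 * 2) by (apply Rmult_le_compat_l; lra).
  assert (g5 : T ^ 2 <= T * (- cos beta / 100)) by nra.
  assert (0 < T * - cos beta) by nra. lra. }
destruct (IVT_interv (closing beta A) 0 T) as [x [hx ex]]; auto.
- intros x hx. apply continuity_pt_filterlim, closing_continuous_sg; auto.
- exists x. assert (x <> 0) by (intros e; rewrite e in ex; lra).
  assert (x <> T) by (intros e; rewrite e in ex; lra).
  repeat split; auto; [lra|]. nra.
Qed.

Definition range_A (beta A : R) : Prop := 1 - eta beta ^ 2 / 2 < A < 1.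

Lemma range_A_bounds (beta A : R) : PI / 2 < beta < PI -> range_A beta A ->
  0 < A < 1 /\ 1 - A ^ 2 <= eta beta ^ 2.
Proof.
intros hb hA. destruct (eta_bounds beta hb) as [e0 [e1 e2]].
destruct (beta_signs beta hb) as [hc _]. unfold range_A in hA. nra.
Qed.

Lemma root_function (beta : R) : PI / 2 < beta < PI ->
  exists sigma : R -> R, forall A, range_A beta A ->
    0 < sigma A /\ 2 * sigma A ^ 2 < 1 - A ^ 2 /\ closing beta A (sigma A) = 0.
Proof.
intros hb.
assert (h : forall A, exists sg, range_A beta A ->
  0 < sg /\ 2 * sg ^ 2 < 1 - A ^ 2 /\ closing beta A sg = 0).
{ intros A. destruct (Rlt_dec (1 - eta beta ^ 2 / 2) A) as [l1|l1];
    [destruct (Rlt_dec A 1) as [l2|l2]|].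
  - destruct (range_A_bounds beta A hb (conj l1 l2)) as [h1 h2].
    destruct (closing_root beta A hb h1 h2) as [sg hs]. now exists sg.
  - exists 0. unfold range_A. lra.
  - exists 0. unfold range_A. lra. }
exists (fun A => proj1_sig (constructive_indefinite_description _ (h A))).
intros A. exact (proj2_sig (constructive_indefinite_description _ (h A))).
Qed.

Lemma near_of_range (beta A sg : R) : PI / 2 < beta < PI -> range_A beta A ->
  0 <= sg -> A ^ 2 + sg ^ 2 <= 1 -> near beta A sg.
Proof.
intros hb hA h1 h2. destruct (range_A_bounds beta A hb hA). repeat split; lra.
Qed.

Lemma closing_root_unique (beta A sg tau : R) : PI / 2 < beta < PI ->
  near beta A sg -> near beta A tau ->
  closing beta A sg = 0 -> closing beta A tau = 0 -> sg = tau.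
Proof.
intros hb hn hm e1 e2. destruct (Rtotal_order sg tau) as [l|[l|l]]; [|exact l|].
- assert (h := closing_incr beta A sg tau hb hn hm l). lra.
- assert (h := closing_incr beta A tau sg hb hm hn l). lra.
Qed.

(** Strict monotonicity in [sg] traps the root between [s - d] and [s + d] as soon as the signs
    at these two values are preserved, which holds near [A] by continuity in [A]. *)
Lemma root_continuous (beta : R) (sigma : R -> R) : PI / 2 < beta < PI ->
  (forall A, range_A beta A ->
    0 < sigma A /\ 2 * sigma A ^ 2 < 1 - A ^ 2 /\ closing beta A (sigma A) = 0) ->
  forall A, range_A beta A -> continuous sigma A.
Proof.
intros hb hsig A hA.
destruct (hsig A hA) as [s1 [s2 s3]].
destruct (range_A_bounds beta A hb hA) as [a1 a2].
set (s := sigma A) in *.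
apply filterlim_locally. intros eps.
(* [d] is small enough for [s - d] and [s + d] to satisfy [near] at [A] and
   at all points close to [A] *)
set (d := Rmin (eps / 2) (Rmin (s / 2) ((1 - A ^ 2) / 8))).
assert (d1 : d <= eps / 2) by apply Rmin_l.
assert (d2 : d <= s / 2) by (apply Rle_trans with (1 := Rmin_r _ _); apply Rmin_l).
assert (d3 : d <= (1 - A ^ 2) / 8) by (apply Rle_trans with (1 := Rmin_r _ _); apply Rmin_r).
assert (heps := cond_pos eps).
assert (d0 : 0 < d) by (unfold d; repeat apply Rmin_pos; nra).
assert (hs1 : s < 1) by nra.
assert (hup : A ^ 2 + (s + d) ^ 2 < 1) by nra.
assert (n0 : near beta A s) by (apply near_of_range; auto; nra).
assert (n1 : near beta A (s - d)) by (apply near_of_range; auto; nra).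
assert (n2 : near beta A (s + d)) by (apply near_of_range; auto; nra).
assert (b1 : closing beta A (s - d) < 0)
  by (rewrite <- s3; apply closing_incr; auto; lra).
assert (b2 : 0 < closing beta A (s + d))
  by (rewrite <- s3; apply closing_incr; auto; lra).
assert (q1 := closing_continuous_A beta A (s - d) hb n1).
assert (q2 := closing_continuous_A beta A (s + d) hb n2).
assert (l1 : locally A (fun t => closing beta t (s - d) < 0)).
{ apply (q1 (fun y => y < 0)). apply open_lt, b1. }
assert (l2 : locally A (fun t => 0 < closing beta t (s + d))).
{ apply (q2 (fun y => 0 < y)). apply open_gt, b2. }
assert (l3 : locally A (fun t => range_A beta t)).
{ apply (locally_interval _ A (1 - eta beta ^ 2 / 2) 1); simpl; unfold range_A in *; try lra.
  intros; simpl in *; lra. }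
assert (l4 : locally A (fun t => t ^ 2 + (s + d) ^ 2 < 1)).
{ assert (q : continuous (fun t => t ^ 2 + (s + d) ^ 2) A).
  { apply (ex_derive_continuous (fun t => t ^ 2 + (s + d) ^ 2)). auto_derive. exact I. }
  apply (q (fun y => y < 1)). apply open_lt, hup. }
generalize (filter_and _ _ (filter_and _ _ l1 l2) (filter_and _ _ l3 l4)).
apply filter_imp. intros t [[t1 t2] [t3 t4]].
destruct (hsig t t3) as [u1 [u2 u3]].
assert (m0 : near beta t (sigma t)) by (apply near_of_range; auto; nra).
assert (m1 : near beta t (s - d)) by (apply near_of_range; auto; nra).
assert (m2 : near beta t (s + d)) by (apply near_of_range; auto; nra).
assert (v1 : s - d < sigma t).
{ destruct (Rtotal_order (s - d) (sigma t)) as [l|[l|l]]; [exact l| |].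
  - rewrite l in t1. lra.
  - assert (h := closing_incr beta t _ _ hb m0 m1 l). lra. }
assert (v2 : sigma t < s + d).
{ destruct (Rtotal_order (sigma t) (s + d)) as [l|[l|l]]; [exact l| |].
  - rewrite <- l in t2. lra.
  - assert (h := closing_incr beta t _ _ hb m2 m0 l). lra. }
unfold ball; simpl; unfold AbsRing_ball, minus, plus, opp, abs; simpl.
fold s. apply Rabs_def1; lra.
Qed.

Lemma root_limit (beta : R) (sigma : R -> R) : PI / 2 < beta < PI ->
  (forall A, range_A beta A -> 0 < sigma A /\ 2 * sigma A ^ 2 < 1 - A ^ 2) ->
  filterlim sigma (at_left 1) (locally 0).
Proof.
intros hb hsig. apply filterlim_locally. intros eps.
assert (h0 := proj1 (eta_bounds beta hb)). assert (he := cond_pos eps).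
assert (hd : exists d, 0 < d /\ d <= eta beta ^ 2 / 2 /\ d <= eps ^ 2 / 2).
{ exists (Rmin (eta beta ^ 2 / 2) (eps ^ 2 / 2)). split; [apply Rmin_pos; nra|].
  split; [apply Rmin_l|apply Rmin_r]. }
destruct hd as [d [hd [m1 m2]]].
exists (mkposreal _ hd). intros A hA hlt.
unfold ball in hA; simpl in hA; unfold AbsRing_ball, minus, plus, opp, abs in hA; simpl in hA.
apply Rabs_def2 in hA.
assert (hr : range_A beta A) by (unfold range_A; lra).
destruct (hsig A hr) as [s1 s2]. destruct (range_A_bounds beta A hb hr) as [a1 _].
unfold ball; simpl; unfold AbsRing_ball, minus, plus, opp, abs; simpl.
assert (sq : 1 - A ^ 2 < eps ^ 2) by nra.
assert (lt : sigma A < eps) by nra.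
apply Rabs_def1; lra.
Qed.

(** * From a steady state to its parameters *)

Lemma curve_first_integral (G : curve) (H : R) (th : R -> R) :
  (forall a, I01 a -> 0 < cr G a) -> const_speed G ->
  (forall a, I01 a -> mean_curv G a = H) -> is_angle G th ->
  cr G 0 * sin (th 0) - H * cr G 0 ^ 2 = cr G 1 * sin (th 1) - H * cr G 1 ^ 2.
Proof.
intros hpos hs hH hth.
destruct (curve_flow G H th hpos hs hH hth) as [r [z [u [v [du [dv [F hag]]]]]]].
assert (i0 : I01 0) by (unfold I01; lra). assert (i1 : I01 1) by (unfold I01; lra).
destruct (hag 0 i0) as [<- [_ [_ ->]]]. destruct (hag 1 i1) as [<- [_ [_ ->]]].
symmetry. exact (flow_first_integral _ _ _ _ _ _ _ _ F 1 i1).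
Qed.

Lemma arc_th_scaled_continuous (a b t x : R) : 0 < b < a ->
  continuous (fun y => arc_th a b (t * y)) x.
Proof.
intros h. apply (continuous_comp (fun y => t * y) (arc_th a b)).
- apply (ex_derive_continuous (fun y => t * y)). auto_derive. exact I.
- now apply arc_th_continuous.
Qed.

(** By rigidity the curve is an arc; lifting the angle identifies [th 1] itself, not only its
    sine and cosine, so that the prescribed end angle will fix the length [t]. *)
Lemma curve_is_arc (G : curve) (a b : R) (th : R -> R) : 0 < b < a ->
  (forall x, I01 x -> 0 < cr G x) -> const_speed G ->
  (forall x, I01 x -> mean_curv G x = - (1 / (2 * b))) -> is_angle G th ->
  cr G 0 = a -> th 0 = PI ->
  exists t, 0 < t /\ arc_th a b t = th 1 /\
    forall x, I01 x -> cr G x = arc_r a b (t * x) /\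
                       cz G x = cz G 0 + arc_z a b (t * x).
Proof.
intros hab hpos hs hH hth hr0 hth0.
destruct (curve_flow G _ th hpos hs hH hth) as [r [z [u [v [du [dv [F hag]]]]]]].
assert (i0 : I01 0) by (unfold I01; lra). assert (i1 : I01 1) by (unfold I01; lra).
destruct (hag 0 i0) as [r0 [z0 [u0 v0]]].
rewrite hth0, cos_PI in u0. rewrite hth0, sin_PI in v0.
assert (hL := flow_len _ _ _ _ _ _ _ _ F).
set (L := arclength G) in *.
assert (E := flow_arc a b L _ _ _ _ _ _ hab F (eq_trans r0 hr0) (eq_sym u0) (eq_sym v0)).
exists (L / b). split; [apply Rdiv_lt_0_compat; lra|]. split.
- rewrite <- (Rmult_1_r (L / b)). symmetry.
  rewrite <- (clamp_id 1 i1) at 1.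
  apply (angle_lift (fun x => th (clamp x)) (fun x => arc_th a b (L / b * x))).
  + apply continuous_clamp. intros x hx. apply hth, hx.
  + intros x. now apply arc_th_scaled_continuous.
  + rewrite clamp_id, Rmult_0_r, arc_th_0 by exact i0. exact hth0.
  + intros x hx. rewrite clamp_id by exact hx.
    destruct (hag x hx) as [_ [_ [-> ->]]]. destruct (E x hx) as [_ [_ [-> ->]]]. auto.
- intros x hx. destruct (hag x hx) as [<- [<- _]]. rewrite <- z0.
  destruct (E x hx) as [-> [-> _]]. auto.
Qed.

Lemma curve_is_reversed_arc (G : curve) (a b : R) (th : R -> R) : 0 < b < a ->
  (forall x, I01 x -> 0 < cr G x) -> const_speed G ->
  (forall x, I01 x -> mean_curv G x = - (1 / (2 * b))) -> is_angle G th ->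
  cr G 1 = a -> th 1 = 0 ->
  exists t, 0 < t /\ arc_th a b t = PI - th 0 /\
    forall x, I01 x -> cr G x = arc_r a b (t * (1 - x)) /\
                       cz G x = cz G 1 - arc_z a b (t * (1 - x)).
Proof.
intros hab hpos hs hH hth hr1 hth1.
destruct (curve_flow G _ th hpos hs hH hth) as [r [z [u [v [du [dv [F hag]]]]]]].
assert (i0 : I01 0) by (unfold I01; lra). assert (i1 : I01 1) by (unfold I01; lra).
destruct (hag 1 i1) as [r1 [z1 [u1 v1]]].
rewrite hth1, cos_0 in u1. rewrite hth1, sin_0 in v1.
assert (hL := flow_len _ _ _ _ _ _ _ _ F).
set (L := arclength G) in *.
apply flow_reverse in F.
assert (E := flow_arc a b L _ _ _ _ _ _ hab F). cbv beta in E.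
rewrite Rminus_0_r in E.
specialize (E (eq_trans r1 hr1) ltac:(lra) (eq_sym v1)).
assert (E' : forall x, I01 x -> r x = arc_r a b (L / b * (1 - x)) /\
  z x = z 1 - arc_z a b (L / b * (1 - x)) /\
  - u x = cos (arc_th a b (L / b * (1 - x))) /\ v x = sin (arc_th a b (L / b * (1 - x)))).
{ intros x hx. assert (hx' : I01 (1 - x)) by (unfold I01 in *; lra).
  destruct (E (1 - x) hx') as [e1 [e2 [e3 e4]]].
  replace (1 - (1 - x)) with x in * by ring. repeat split; auto; lra. }
exists (L / b). split; [apply Rdiv_lt_0_compat; lra|]. split.
- rewrite <- (Rmult_1_r (L / b)). symmetry.
  replace (th 0) with (th (clamp (1 - 1)))
    by (rewrite Rminus_diag, clamp_id by exact i0; reflexivity).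
  apply (angle_lift (fun x => PI - th (clamp (1 - x))) (fun x => arc_th a b (L / b * x))).
  + intros x. apply (continuous_minus (fun _ => PI)); [apply continuous_const|].
    apply (continuous_comp (fun x => 1 - x) (fun x => th (clamp x))).
    * apply (ex_derive_continuous (fun y => 1 - y)). auto_derive. exact I.
    * apply continuous_clamp. intros y hy. apply hth, hy.
  + intros x. now apply arc_th_scaled_continuous.
  + rewrite Rminus_0_r, clamp_id, Rmult_0_r, arc_th_0 by exact i1. lra.
  + intros x hx. assert (hx' : I01 (1 - x)) by (unfold I01 in *; lra).
    rewrite clamp_id by exact hx'.
    rewrite Rtrigo_facts.cos_pi_minus, Rtrigo_facts.sin_pi_minus.
    destruct (hag (1 - x) hx') as [_ [_ [-> ->]]].
    destruct (E' (1 - x) hx') as [_ [_ [e3 e4]]].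
    replace (1 - (1 - x)) with x in * by ring. auto.
- intros x hx. destruct (hag x hx) as [<- [<- _]]. rewrite <- z1.
  destruct (E' x hx) as [-> [-> _]]. auto.
Qed.

Lemma catenary_z_derive (A L x : R) : 0 < A ->
  is_derive (fun x => A * arcsinh (L * x / A)) x (L * (A / rbar A (L * x))).
Proof.
intros hA. assert (hr := rbar_pos A (L * x) hA).
auto_derive.
- repeat split; try lra; eexists; apply arcsinh_derive.
- rewrite (Derive_eq arcsinh _ arcsinh_derive).
  change (L * x * / A) with (L * x / A). rewrite sqrt_rbar by exact hA. field. lra.
Qed.

(** With [H = 0] the first integral is [r * v = A], and [(r * u)' = L] because [(u, v)] is a
    unit vector; hence [r ^ 2 = A ^ 2 + (L * x) ^ 2]. *)
Lemma curve_is_catenary (G : curve) (A : R) (th : R -> R) : 0 < A ->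
  (forall x, I01 x -> 0 < cr G x) -> const_speed G ->
  (forall x, I01 x -> mean_curv G x = 0) -> is_angle G th ->
  cr G 0 = A -> cz G 0 = 0 -> th 0 = PI / 2 ->
  0 < arclength G /\
  forall x, I01 x -> cr G x = rbar A (arclength G * x) /\
    cz G x = A * arcsinh (arclength G * x / A) /\
    cr G x * cos (th x) = arclength G * x /\ cr G x * sin (th x) = A.
Proof.
intros hA hpos hs hH hth hr0 hz0 hth0.
destruct (curve_flow G _ th hpos hs hH hth) as [r [z [u [v [du [dv [F hag]]]]]]].
assert (i0 : I01 0) by (unfold I01; lra). assert (i1 : I01 1) by (unfold I01; lra).
set (L := arclength G) in *.
destruct (hag 0 i0) as [r0 [z0 [u0 v0]]].
rewrite hth0, cos_PI2 in u0. rewrite hth0, sin_PI2 in v0.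
rewrite hr0 in r0. rewrite hz0 in z0.
assert (FF := F). destruct FF as [f1 f2 f3 f4 f5 f6 f7 f8 f9].
split; [exact f1|].
assert (erv : forall x, I01 x -> r x * v x = A).
{ intros x hx. assert (e := flow_first_integral _ _ _ _ _ _ _ _ F x hx).
  rewrite r0, <- v0 in e. lra. }
assert (eru : forall x, I01 x -> r x * u x = L * x).
{ intros x hx.
  assert (e : r x * u x - L * x = r 0 * u 0 - L * 0).
  { apply (derive_zero_const01 (fun x => r x * u x - L * x)
      (fun x => L * u x * u x + r x * du x - L)); [| |exact hx].
    - intros y. auto_derive.
      + repeat split; eexists; [apply f2|apply f4].
      + rewrite (Derive_eq r _ f2), (Derive_eq u _ f4). ring.
    - intros y hy. assert (hy' : I01 y) by (unfold I01; lra).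
      assert (hp := f6 y hy'). rewrite f8 by exact hy.
      transitivity (L * (u y ^ 2 + v y ^ 2) - L); [field; lra|].
      rewrite f7 by exact hy'. ring. }
  rewrite <- u0 in e. lra. }
assert (er : forall x, I01 x -> r x = rbar A (L * x)).
{ intros x hx. assert (hp := f6 x hx).
  rewrite <- (sqrt_pow2 (r x)) by lra. unfold rbar. f_equal.
  rewrite <- (eru x hx), <- (erv x hx).
  transitivity (r x ^ 2 * (u x ^ 2 + v x ^ 2)); [|ring]. rewrite f7 by exact hx. ring. }
intros x hx. destruct (hag x hx) as [e1 [e2 [-> ->]]]. rewrite <- e1, <- e2.
repeat split; auto.
assert (e : z x - A * arcsinh (L * x / A) = z 0 - A * arcsinh (L * 0 / A)).
{ apply (derive_zero_const01 (fun x => z x - A * arcsinh (L * x / A))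
      (fun x => L * v x - L * (A / rbar A (L * x)))); [| |exact hx].
  - intros y. apply (is_derive_minus z); [apply f3|now apply catenary_z_derive].
  - intros y hy. assert (hy' : I01 y) by (unfold I01; lra).
    rewrite <- (er y hy'), <- (erv y hy'). field. apply Rgt_not_eq, f6, hy'. }
rewrite Rmult_0_r in e. replace (0 / A) with 0 in e by (unfold Rdiv; ring).
rewrite arcsinh_0 in e. lra.
Qed.

Lemma angle_of_cos_pos (x : R) : - PI < x <= PI -> 0 < cos x -> - PI / 2 < x < PI / 2.
Proof.
intros hx hc. assert (hpi := PI_RGT_0). split.
- destruct (Rlt_le_dec (- PI / 2) x) as [l|l]; [exact l|].
  assert (cos (- x) <= 0) by (apply cos_le_0; lra). rewrite cos_neg in H. lra.
- destruct (Rlt_le_dec x (PI / 2)) as [l|l]; [exact l|].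
  assert (cos x <= 0) by (apply cos_le_0; lra). lra.
Qed.

(** [t1] and [t2] are the arclengths of the drop and of the outer surface divided by
    [bend_radius]; the outer surface is traversed backwards from the cylinder [r = 1]. *)
Definition explicit_config (beta A sg t1 t2 : R) (S : config) : Prop :=
  let b := bend_radius beta A sg in let a := sqrt (inner_radius2 beta A sg) in
  arc_th a b t1 = theta1bar A sg beta /\
  arc_th 1 b t2 = PI - (theta3bar A sg - PI + beta) /\
  forall x, I01 x ->
    (cr (Gam1 S) x = arc_r a b (t1 * x) /\ cz (Gam1 S) x = arc_z a b (t1 * x)) /\
    (cr (Gam2 S) x = arc_r 1 b (t2 * (1 - x)) /\
     cz (Gam2 S) x = zbar A sg + arc_z 1 b t2 - arc_z 1 b (t2 * (1 - x))) /\
    (cr (Gam3 S) x = rbar A (sg * x) /\ cz (Gam3 S) x = A * arcsinh (sg * x / A)).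

(** The first integral on the outer surface gives [lambda = lam A sg beta], the one on the drop
    gives the contact radius [a_ell], and the heights of the drop and of the catenoid agree
    at the junction, which is the closing condition. *)
Lemma steady_state_explicit (beta : R) (S : config) : PI / 2 < beta < PI ->
  steady_state beta PI S -> range_A beta (r3star S) ->
  let A := r3star S in let sg := arclength (Gam3 S) in
  near beta A sg /\ closing beta A sg = 0 /\
  exists t1 t2, explicit_config beta A sg t1 t2 S.
Proof.
intros hb hS hA A sg.
destruct hS as [p13 [p2 [_ [_ [hpts [[s1 [s2 s3]] [[lambda hH] [hang _]]]]]]]].
destruct hpts as [r1s [r3s [z2s [rb [zb [q1 [q2 [q3 [q4 [q5 [g10 [g11 [g20 [g21 [g30 [g31
  _]]]]]]]]]]]]]]]].
destruct hang as [th1 [th2 [th3 [a1 [a2 [a3 [t10 [t21 [t30 [tb1 tb2]]]]]]]]]].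
unfold at_point in *.
assert (i0 : I01 0) by (unfold I01; lra). assert (i1 : I01 1) by (unfold I01; lra).
assert (pos1 : forall x, I01 x -> 0 < cr (Gam1 S) x) by (intros x hx; apply (p13 x hx)).
assert (pos3 : forall x, I01 x -> 0 < cr (Gam3 S) x) by (intros x hx; apply (p13 x hx)).
assert (pos2 : forall x, I01 x -> 0 < cr (Gam2 S) x).
{ intros x hx. unfold I01 in hx. destruct (Req_dec x 1) as [e|e].
  - rewrite e, (proj1 g21). lra.
  - apply p2; lra. }
assert (H1 : forall x, I01 x -> mean_curv (Gam1 S) x = lambda) by (intros; now apply hH).
assert (H2 : forall x, I01 x -> mean_curv (Gam2 S) x = lambda) by (intros; now apply hH).
assert (H3 : forall x, I01 x -> mean_curv (Gam3 S) x = 0) by (intros; now apply hH).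
destruct (range_A_bounds beta A hb hA) as [bA bA2].
assert (eA : cr (Gam3 S) 0 = A) by reflexivity.
destruct (curve_is_catenary (Gam3 S) A th3 (proj1 bA) pos3 s3 H3 a3 eA (proj2 g30) t30)
  as [hsg C]. fold sg in hsg, C. change (r3star S) with A in hA. clearbody A sg.
destruct (C 1 i1) as [c1 [c2 [c3 c4]]]. rewrite Rmult_1_r in *.
rewrite (proj1 g31) in c1, c3, c4. rewrite (proj2 g31) in c2.
assert (hr := rbar_pos A sg (proj1 bA)). assert (hr2 := rbar_sqr A sg).
rewrite <- zbar_arcsinh in c2 by lra.
assert (hn : near beta A sg) by (apply near_of_range; auto; nra).
assert (hd : 0 < outer_gap A sg) by (unfold outer_gap; nra).
destruct (near_bounds beta A sg hb hn) as [n1 [n2 [n3 [n4 _]]]].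
destruct (beta_signs beta hb) as [hc [hsn hcs]].
assert (hbb : 0 < bend_radius beta A sg) by (apply Rdiv_lt_0_compat; lra).
assert (hbb2 := bend_radius_bounds beta A sg hb hn).
assert (hbb3 := eta_bounds beta hb).
assert (ha := sqrt_inner_radius2_bounds beta A sg hb hn).
assert (haa := inner_radius2_bounds beta A sg hb hn).
(* [cos > 0] and the range (-PI, PI] of the angle select the arcsine branch *)
assert (et3 : th3 1 = theta3bar A sg).
{ destruct (a3 1 i1) as [_ [b3 _]].
  assert (h := angle_of_cos_pos (th3 1) b3 ltac:(nra)).
  rewrite <- (asin_sin (th3 1)) by lra. unfold theta3bar. f_equal.
  rewrite <- c1. apply (Rmult_eq_reg_l rb); [|lra]. rewrite c4. field. lra. }
rewrite et3 in *.
assert (sb : rb * sin (theta3bar A sg) = A) by exact c4.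
assert (cb : rb * cos (theta3bar A sg) = sg) by exact c3.
assert (elam : lambda = - (1 / (2 * bend_radius beta A sg))).
{ assert (e := curve_first_integral _ _ _ pos2 s2 H2 a2).
  rewrite (proj1 g20), (proj1 g21), t21, sin_0 in e.
  replace (th2 0) with (- (PI - (theta3bar A sg + beta))) in e by lra.
  rewrite sin_neg, Rtrigo_facts.sin_pi_minus, sin_plus in e.
  assert (e' : junction_lift beta A sg = lambda * (rb ^ 2 - 1)).
  { assert (x : rb * (sin (theta3bar A sg) * cos beta + cos (theta3bar A sg) * sin beta)
              = A * cos beta + sg * sin beta).
    { rewrite Rmult_plus_distr_l, <- !Rmult_assoc, sb, cb. ring. }
    unfold junction_lift. lra. }
  assert (e'' : rb ^ 2 - 1 = - outer_gap A sg) by (unfold outer_gap; rewrite c1, hr2; ring).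
  rewrite e'' in e'.
  assert (l0 : lambda <> 0) by (intros l0; rewrite l0 in e'; lra).
  unfold bend_radius. rewrite e'. field. lra. }
assert (er1 : r1s = sqrt (inner_radius2 beta A sg)).
{ assert (e := curve_first_integral _ _ _ pos1 s1 H1 a1).
  rewrite (proj1 g10), (proj1 g11), t10, sin_PI in e.
  replace (th1 1) with (theta3bar A sg - beta) in e by lra.
  rewrite sin_minus, elam in e.
  assert (e' : r1s ^ 2 = rb ^ 2 + 2 * bend_radius beta A sg * (A * cos beta - sg * sin beta)).
  { assert (x : rb * (sin (theta3bar A sg) * cos beta - cos (theta3bar A sg) * sin beta)
              = A * cos beta - sg * sin beta).
    { rewrite Rmult_minus_distr_l, <- !Rmult_assoc, sb, cb. ring. }
    rewrite x in e.
    apply (Rmult_eq_reg_l (1 / (2 * bend_radius beta A sg)));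
      [|apply Rgt_not_eq, Rdiv_lt_0_compat; lra].
    transitivity (r1s * 0 - - (1 / (2 * bend_radius beta A sg)) * r1s ^ 2); [ring|].
    rewrite e. field. lra. }
  symmetry. apply sqrt_lem_1; try lra.
  replace (r1s * r1s) with (r1s ^ 2) by ring. rewrite e', c1, hr2.
  unfold inner_radius2, bend_radius, outer_gap. unfold junction_lift in *. field. lra. }
rewrite elam in H1, H2.
destruct (curve_is_arc (Gam1 S) (sqrt (inner_radius2 beta A sg)) (bend_radius beta A sg) th1
  ltac:(lra) pos1 s1 H1 a1 (eq_trans (proj1 g10) er1) t10) as [t1 [ht1 [et1 E1]]].
destruct (curve_is_reversed_arc (Gam2 S) 1 (bend_radius beta A sg) th2
  ltac:(lra) pos2 s2 H2 a2 (proj1 g21) t21) as [t2 [ht2 [et2 E2]]].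
assert (et1' : arc_th (sqrt (inner_radius2 beta A sg)) (bend_radius beta A sg) t1 =
  theta1bar A sg beta)
  by (rewrite et1; unfold theta1bar; lra).
split; [exact hn|]. split.
- destruct (E1 1 i1) as [_ e]. rewrite (proj2 g11), (proj2 g10), Rmult_1_r in e.
  rewrite arc_height, et1', c2 in e by lra.
  rewrite <- z1_closing by assumption. rewrite z1_height by lra. rewrite e. ring.
- exists t1, t2. split; [exact et1'|]. split; [rewrite et2; lra|].
  intros x hx. destruct (E1 x hx) as [e1 e2]. destruct (E2 x hx) as [f1 f2].
  destruct (C x hx) as [k1 [k2 _]].
  rewrite e1, e2, f1, f2, k1, k2, (proj2 g10). repeat split; try lra.
  destruct (E2 0 i0) as [_ m]. rewrite (proj2 g20), Rminus_0_r, Rmult_1_r, c2 in m. lra.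
Qed.

(** The angular extents determine [t1] and [t2] because the tangent angle is strictly monotone. *)
Lemma explicit_config_unique (beta A sg t1 t2 u1 u2 : R) (S S' : config) :
  PI / 2 < beta < PI -> near beta A sg -> 0 < outer_gap A sg ->
  explicit_config beta A sg t1 t2 S -> explicit_config beta A sg u1 u2 S' ->
  same_config S S'.
Proof.
intros hb hn hd [e1 [e2 e3]] [f1 [f2 f3]].
destruct (near_bounds beta A sg hb hn) as [n1 [n2 [n3 [n4 _]]]].
destruct (beta_signs beta hb) as [hc [hsn hcs]].
assert (hbb : 0 < bend_radius beta A sg) by (apply Rdiv_lt_0_compat; lra).
assert (hbb2 := bend_radius_bounds beta A sg hb hn).
assert (hbb3 := eta_bounds beta hb).
assert (ha := sqrt_inner_radius2_bounds beta A sg hb hn).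
assert (g1 : t1 = u1).
{ apply (arc_th_inj (sqrt (inner_radius2 beta A sg)) (bend_radius beta A sg)); [lra|]. now
    rewrite e1, f1. }
assert (g2 : t2 = u2).
{ apply (arc_th_inj 1 (bend_radius beta A sg)); [lra|]. now rewrite e2, f2. }
subst u1 u2.
repeat split; intros; destruct (e3 _ H) as [[? ?] [[? ?] [? ?]]];
  destruct (f3 _ H) as [[? ?] [[? ?] [? ?]]]; congruence.
Qed.

(** * Curves with a prescribed tangent angle *)

(** With constant speed the principal curvatures are [dth / L] and [sin th / r]. *)
Lemma curve_of_angle (L : R) (r z th dth : R -> R) : 0 < L ->
  (forall x, is_derive r x (L * cos (th x))) ->
  (forall x, is_derive z x (L * sin (th x))) ->
  (forall x, is_derive th x (dth x)) -> (forall x, continuous dth x) ->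
  (forall x, I01 x -> 0 < r x) -> (forall x, I01 x -> - PI < th x <= PI) ->
  exists G : curve, (forall x, cr G x = r x /\ cz G x = z x) /\
    const_speed G /\ arclength G = L /\ is_angle G th /\
    (forall x, I01 x -> mean_curv G x = (dth x / L + sin (th x) / r x) / 2).
Proof.
intros hL hr hz ht hc hpos hang.
assert (cth : forall x, continuous th x)
  by (intros x; apply (ex_derive_continuous th); eexists; apply ht).
assert (D := Derive_eq th dth ht).
assert (hr2 : forall x, is_derive (fun x => L * cos (th x)) x (- (L * sin (th x) * dth x))).
{ intros x. auto_derive; [eexists; apply ht|]. rewrite D. ring. }
assert (hz2 : forall x, is_derive (fun x => L * sin (th x)) x (L * cos (th x) * dth x)).
{ intros x. auto_derive; [eexists; apply ht|]. rewrite D. ring. }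
assert (hr3 : forall x, continuous (fun x => - (L * sin (th x) * dth x)) x).
{ intros x. apply (continuous_opp (fun x => L * sin (th x) * dth x)).
  apply (continuous_mult (fun x => L * sin (th x)) dth); [|apply hc].
  apply (ex_derive_continuous (fun x => L * sin (th x))). eexists; apply hz2. }
assert (hz3 : forall x, continuous (fun x => L * cos (th x) * dth x) x).
{ intros x.
  apply (continuous_mult (fun x => L * cos (th x)) dth); [|apply hc].
  apply (ex_derive_continuous (fun x => L * cos (th x))). eexists; apply hr2. }
exists (mkCurve (C2_of_derivatives r _ _ hr hr2 hr3) (C2_of_derivatives z _ _ hz hz2 hz3)).
set (G := mkCurve _ _).
assert (sc : forall x, cos (th x) ^ 2 + sin (th x) ^ 2 = 1).
{ intros x. assert (e := sin2_cos2 (th x)). unfold Rsqr in e. lra. }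
assert (sp : forall x, speed2 G x = L ^ 2).
{ intros x. unfold speed2; simpl d1.
  transitivity (L ^ 2 * (cos (th x) ^ 2 + sin (th x) ^ 2)); [ring|]. rewrite sc. ring. }
assert (sq : sqrt (L ^ 2) = L) by (apply sqrt_pow2; lra).
split; [intros; split; reflexivity|].
split; [exists (L ^ 2); split; [nra|intros; apply sp]|].
split; [rewrite <- sq; apply arclength_const_speed; intros; apply sp|].
split.
- intros x hx. rewrite sp, sq. simpl d1.
  split; [apply continuous_continue_in, cth|]. split; [now apply hang|].
  split; field; lra.
- intros x hx. assert (hp := hpos x hx). unfold mean_curv.
  rewrite sp, Rpower_3_2, sq by nra. simpl.
  transitivity (((cos (th x) ^ 2 + sin (th x) ^ 2) * dth x / L + sin (th x) / r x) / 2).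
  + field. lra.
  + rewrite sc. now rewrite Rmult_1_l.
Qed.

Lemma arc_dth_continuous (a b t : R) : 0 < b < a -> continuous (arc_dth a b) t.
Proof.
intros h. apply (ex_derive_continuous (arc_dth a b)). unfold arc_dth.
assert (hr := arc_r_pos a b t h).
auto_derive. repeat split; try (eexists; now apply arc_r_derive). nra.
Qed.

Lemma arc_mean_curv (a b t : R) : 0 < b < a ->
  (arc_dth a b t / b + sin (arc_th a b t) / arc_r a b t) / 2 = - (1 / (2 * b)).
Proof.
intros h. assert (hr := arc_r_pos a b t h). assert (e := arc_first_integral a b t h).
set (r := arc_r a b t) in *. set (S := sin (arc_th a b t)) in *.
unfold arc_dth. fold r.
replace (S / r) with (- (r ^ 2 - a ^ 2) / (2 * b * r ^ 2)) by (rewrite e; field; lra).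
field. lra.
Qed.

Lemma scaled_derive (f df : R -> R) (t x : R) : (forall y, is_derive f y (df y)) ->
  is_derive (fun y => f (t * y)) x (t * df (t * x)).
Proof.
intros h. apply (is_derive_comp f (fun y => t * y)); [apply h|].
auto_derive; [exact I|ring].
Qed.

Lemma reversed_derive (f df : R -> R) (t x : R) : (forall y, is_derive f y (df y)) ->
  is_derive (fun y => f (t * (1 - y))) x (- (t * df (t * (1 - x)))).
Proof.
intros h.
replace (- (t * df (t * (1 - x)))) with (- t * df (t * (1 - x))) by ring.
apply (is_derive_comp f (fun y => t * (1 - y))); [apply h|].
auto_derive; [exact I|ring].
Qed.

Lemma arc_curve (a b t : R) : 0 < b < a -> 0 < t -> - PI < arc_th a b t ->
  exists G : curve,
    (forall x, cr G x = arc_r a b (t * x) /\ cz G x = arc_z a b (t * x)) /\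
    const_speed G /\ is_angle G (fun x => arc_th a b (t * x)) /\
    (forall x, I01 x -> mean_curv G x = - (1 / (2 * b))).
Proof.
intros h ht hth.
destruct (curve_of_angle (t * b) (fun x => arc_r a b (t * x)) (fun x => arc_z a b (t * x))
  (fun x => arc_th a b (t * x)) (fun x => t * arc_dth a b (t * x)))
  as [G [g1 [g2 [_ [g3 g4]]]]].
- nra.
- intros x. rewrite Rmult_assoc.
  apply (scaled_derive (arc_r a b) (fun y => b * cos (arc_th a b y))).
  intros; now apply arc_r_derive.
- intros x. rewrite Rmult_assoc.
  apply (scaled_derive (arc_z a b) (fun y => b * sin (arc_th a b y))).
  intros; now apply arc_z_derive.
- intros x. apply (scaled_derive (arc_th a b)). intros; now apply arc_th_derive.
- intros x. apply (continuous_mult (fun _ => t)); [apply continuous_const|].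
  apply (continuous_comp (fun y => t * y) (arc_dth a b)).
  + apply (ex_derive_continuous (fun y => t * y)). auto_derive. exact I.
  + now apply arc_dth_continuous.
- intros x _. now apply arc_r_pos.
- intros x hx. unfold I01 in hx. split.
  + apply Rlt_le_trans with (1 := hth). apply arc_th_decr_le; [exact h|nra].
  + rewrite <- (arc_th_0 a b). apply arc_th_decr_le; [exact h|nra].
- exists G. repeat split; try apply g1; auto; try apply g3; auto.
  intros x hx. rewrite g4 by exact hx. rewrite <- (arc_mean_curv a b (t * x) h).
  do 2 f_equal. field. lra.
Qed.

Lemma reversed_arc_curve (a b t z0 : R) : 0 < b < a -> 0 < t -> 0 <= arc_th a b t ->
  exists G : curve,
    (forall x, cr G x = arc_r a b (t * (1 - x)) /\
               cz G x = z0 - arc_z a b (t * (1 - x))) /\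
    const_speed G /\ is_angle G (fun x => PI - arc_th a b (t * (1 - x))) /\
    (forall x, I01 x -> mean_curv G x = - (1 / (2 * b))).
Proof.
intros h ht hth.
destruct (curve_of_angle (t * b) (fun x => arc_r a b (t * (1 - x)))
  (fun x => z0 - arc_z a b (t * (1 - x)))
  (fun x => PI - arc_th a b (t * (1 - x))) (fun x => t * arc_dth a b (t * (1 - x))))
  as [G [g1 [g2 [_ [g3 g4]]]]].
- nra.
- intros x. rewrite Rtrigo_facts.cos_pi_minus.
  replace (t * b * - cos (arc_th a b (t * (1 - x))))
    with (- (t * (b * cos (arc_th a b (t * (1 - x)))))) by ring.
  apply (reversed_derive (arc_r a b) (fun y => b * cos (arc_th a b y))).
  intros; now apply arc_r_derive.
- intros x. rewrite Rtrigo_facts.sin_pi_minus.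
  replace (t * b * sin (arc_th a b (t * (1 - x))))
    with (0 - - (t * (b * sin (arc_th a b (t * (1 - x)))))) by ring.
  apply (is_derive_minus (fun _ => z0)); [apply (@is_derive_const R_AbsRing)|].
  apply (reversed_derive (arc_z a b) (fun y => b * sin (arc_th a b y))).
  intros; now apply arc_z_derive.
- intros x.
  replace (t * arc_dth a b (t * (1 - x)))
    with (0 - - (t * arc_dth a b (t * (1 - x)))) by ring.
  apply (is_derive_minus (fun _ => PI)); [apply (@is_derive_const R_AbsRing)|].
  apply (reversed_derive (arc_th a b)). intros; now apply arc_th_derive.
- intros x. apply (continuous_mult (fun _ => t)); [apply continuous_const|].
  apply (continuous_comp (fun y => t * (1 - y)) (arc_dth a b)).
  + apply (ex_derive_continuous (fun y => t * (1 - y))). auto_derive. exact I.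
  + now apply arc_dth_continuous.
- intros x _. now apply arc_r_pos.
- intros x hx. unfold I01 in hx.
  assert (0 <= arc_th a b (t * (1 - x)) <= PI).
  { split.
    + apply Rle_trans with (1 := hth). apply arc_th_decr_le; [exact h|nra].
    + rewrite <- (arc_th_0 a b). apply arc_th_decr_le; [exact h|nra]. }
  assert (hpi := PI_RGT_0). lra.
- exists G. repeat split; try apply g1; auto; try apply g3; auto.
  intros x hx. rewrite g4 by exact hx. rewrite Rtrigo_facts.sin_pi_minus.
  rewrite <- (arc_mean_curv a b (t * (1 - x)) h).
  do 2 f_equal. field. lra.
Qed.

Lemma rbar_derive (A sg x : R) : 0 < A ->
  is_derive (fun x => rbar A (sg * x)) x (sg * (sg * x / rbar A (sg * x))).
Proof.
intros hA. assert (hr := rbar_pos A (sg * x) hA).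
assert (hp : 0 < (sg * x) ^ 2 + A ^ 2) by nra.
unfold rbar in *. auto_derive.
- apply Rlt_le_trans with (1 := hp). right; ring.
- replace (sg * x * (sg * x * 1) + A * (A * 1)) with ((sg * x) ^ 2 + A ^ 2) by ring.
  field. lra.
Qed.

Lemma catenary_curve (A sg : R) : 0 < A -> 0 < sg ->
  exists G : curve,
    (forall x, cr G x = rbar A (sg * x) /\ cz G x = A * arcsinh (sg * x / A)) /\
    const_speed G /\ arclength G = sg /\
    is_angle G (fun x => PI / 2 - atan (sg * x / A)) /\
    (forall x, I01 x -> mean_curv G x = 0).
Proof.
intros hA hs.
assert (hsn : forall x, sin (PI / 2 - atan (sg * x / A)) = A / rbar A (sg * x)).
{ intros x. assert (hr := rbar_pos A (sg * x) hA). rewrite sin_shift, cos_atan.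
  replace (1 + (sg * x / A)²) with ((sg * x / A) ^ 2 + 1) by (unfold Rsqr; ring).
  rewrite sqrt_rbar by exact hA. field. lra. }
assert (hcs : forall x, cos (PI / 2 - atan (sg * x / A)) = sg * x / rbar A (sg * x)).
{ intros x. assert (hr := rbar_pos A (sg * x) hA). rewrite cos_shift, sin_atan.
  replace (1 + (sg * x / A)²) with ((sg * x / A) ^ 2 + 1) by (unfold Rsqr; ring).
  rewrite sqrt_rbar by exact hA. field. lra. }
assert (hpi := PI_RGT_0).
destruct (curve_of_angle sg (fun x => rbar A (sg * x)) (fun x => A * arcsinh (sg * x / A))
  (fun x => PI / 2 - atan (sg * x / A)) (fun x => - (sg * A / ((sg * x) ^ 2 + A ^ 2))))
  as [G [g1 [g2 [g3 [g4 g5]]]]].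
- exact hs.
- intros x. rewrite hcs. now apply rbar_derive.
- intros x. rewrite hsn. now apply catenary_z_derive.
- intros x. assert (hp : 0 < (sg * x) ^ 2 + A ^ 2) by nra.
  auto_derive; [lra|]. field. split; [nra|lra].
- intros x. assert (hp : 0 < (sg * x) ^ 2 + A ^ 2) by nra.
  apply (ex_derive_continuous (fun x => - (sg * A / ((sg * x) ^ 2 + A ^ 2)))).
  auto_derive. nra.
- intros x _. now apply rbar_pos.
- intros x _. assert (b := atan_bound (sg * x / A)). lra.
- exists G. repeat split; try apply g1; auto; try apply g4; auto.
  intros x hx. rewrite g5, hsn by exact hx. rewrite <- rbar_sqr.
  assert (hr := rbar_pos A (sg * x) hA). field. lra.
Qed.

(** * Shape of nodoid arcs *)

(** The two roots of the first integral in [r] have product [- a ^ 2]. *)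
Lemma arc_r_unique (a b t rho : R) : 0 < b < a -> 0 < rho ->
  rho ^ 2 - a ^ 2 = - 2 * b * (rho * sin (arc_th a b t)) -> arc_r a b t = rho.
Proof.
intros h hrho e. assert (hr := arc_r_pos a b t h).
assert (e' := arc_first_integral a b t h).
set (r := arc_r a b t) in *. set (S := sin (arc_th a b t)) in *.
assert (hf : (r - rho) * (r * rho + a ^ 2) = 0).
{ transitivity (rho * (r ^ 2 - a ^ 2) - r * (rho ^ 2 - a ^ 2)); [ring|].
  rewrite e, e'. ring. }
apply Rmult_integral in hf. destruct hf; [lra|nra].
Qed.

(** By the first integral, [r <= a] is equivalent to [0 <= sin th]. *)
Lemma arc_r_le (a b t : R) : 0 < b < a -> 0 <= t -> 0 <= arc_th a b t ->
  arc_r a b t <= a.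
Proof.
intros h ht hth. assert (hr := arc_r_pos a b t h).
assert (e := arc_first_integral a b t h).
assert (hs : 0 <= sin (arc_th a b t)).
{ apply sin_ge_0; [exact hth|]. rewrite <- (arc_th_0 a b). now apply arc_th_decr_le. }
assert (0 <= b * (arc_r a b t * sin (arc_th a b t))) by (apply Rmult_le_pos; nra).
nra.
Qed.

Lemma arc_th_between (a b t u v : R) : 0 < b < a -> t < u < v ->
  arc_th a b v < arc_th a b u < arc_th a b t.
Proof. intros h hu. split; apply arc_th_decr; lra. Qed.

Lemma arc_z_incr (a b t u : R) : 0 < b < a -> 0 <= t < u -> 0 <= arc_th a b u ->
  arc_z a b t < arc_z a b u.
Proof.
intros h ht hu. apply (derive_pos_increasing _ (fun x => b * sin (arc_th a b x))).
- intros; now apply arc_z_derive.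
- intros x hx. assert (hb := arc_th_between a b t x u h hx).
  assert (hp : arc_th a b t <= PI)
    by (rewrite <- (arc_th_0 a b); apply arc_th_decr_le; lra).
  apply Rmult_lt_0_compat; [lra|]. apply sin_gt_0; lra.
- lra.
Qed.

Lemma arc_z_decr (a b t u : R) : 0 < b < a -> t < u -> arc_th a b t <= 0 ->
  - PI <= arc_th a b u -> arc_z a b u < arc_z a b t.
Proof.
intros h ht h0 hu.
apply (derive_neg_decreasing _ (fun x => b * sin (arc_th a b x))).
- intros; now apply arc_z_derive.
- intros x hx. assert (hb := arc_th_between a b t x u h hx).
  assert (sin (arc_th a b x) < 0) by (apply sin_lt_0_var; lra). nra.
- exact ht.
Qed.

Lemma arc_r_incr (a b t u : R) : 0 < b < a -> t < u -> arc_th a b t <= PI / 2 ->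
  - (PI / 2) <= arc_th a b u -> arc_r a b t < arc_r a b u.
Proof.
intros h ht h0 hu.
apply (derive_pos_increasing _ (fun x => b * cos (arc_th a b x))).
- intros; now apply arc_r_derive.
- intros x hx. assert (hb := arc_th_between a b t x u h hx).
  apply Rmult_lt_0_compat; [lra|]. apply cos_gt_0; lra.
- exact ht.
Qed.

Lemma arc_r_decr (a b t u : R) : 0 < b < a -> 0 <= t < u -> PI / 2 <= arc_th a b u ->
  arc_r a b u < arc_r a b t.
Proof.
intros h ht hu.
apply (derive_neg_decreasing _ (fun x => b * cos (arc_th a b x))).
- intros; now apply arc_r_derive.
- intros x hx. assert (hb := arc_th_between a b t x u h hx).
  assert (hp : arc_th a b t <= PI)
    by (rewrite <- (arc_th_0 a b); apply arc_th_decr_le; lra).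
  assert (hpi := PI_RGT_0).
  assert (cos (arc_th a b x) < 0) by (apply cos_lt_0; lra). nra.
- lra.
Qed.

(** At equal radii the first integral gives equal sines, so the two tangent angles are
    supplementary and nonnegative: the arc goes up all the way between the two points, which
    then have different heights. *)
Lemma arc_no_crossing (a b T t u : R) : 0 < b < a -> - (PI / 2) <= arc_th a b T ->
  0 <= t < u -> u <= T ->
  arc_r a b t = arc_r a b u -> arc_z a b t = arc_z a b u -> False.
Proof.
intros h hT ht hu er ez. assert (hpi := PI_RGT_0).
assert (hlt : arc_th a b u < arc_th a b t) by (apply arc_th_decr; lra).
assert (hge : arc_th a b T <= arc_th a b u) by (apply arc_th_decr_le; lra).
assert (hle : arc_th a b t <= PI)
  by (rewrite <- (arc_th_0 a b); apply arc_th_decr_le; lra).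
assert (hs : sin (arc_th a b t) = sin (arc_th a b u)).
{ assert (e1 := arc_first_integral a b t h). assert (e2 := arc_first_integral a b u h).
  assert (hr := arc_r_pos a b u h). rewrite er in e1. rewrite e2 in e1.
  assert (hp : 0 < b * arc_r a b u) by nra.
  apply (Rmult_eq_reg_l (b * arc_r a b u)); lra. }
assert (inj : forall x y, - (PI / 2) <= x <= PI / 2 -> - (PI / 2) <= y <= PI / 2 ->
  sin x = sin y -> x = y).
{ intros x y hx hy e. rewrite <- (asin_sin x), <- (asin_sin y) by lra. now rewrite e. }
destruct (Rle_lt_dec (arc_th a b t) (PI / 2)) as [l|l].
- assert (e := inj (arc_th a b t) (arc_th a b u) ltac:(lra) ltac:(lra) hs). lra.
- destruct (Rle_lt_dec (arc_th a b u) (PI / 2)) as [m|m].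
  + rewrite <- (Rtrigo_facts.sin_pi_minus (arc_th a b t)) in hs.
    assert (e := inj (PI - arc_th a b t) (arc_th a b u) ltac:(lra) ltac:(lra) hs).
    assert (hz := arc_z_incr a b t u h ht ltac:(lra)). lra.
  + rewrite <- (Rtrigo_facts.sin_pi_minus (arc_th a b t)) in hs.
    rewrite <- (Rtrigo_facts.sin_pi_minus (arc_th a b u)) in hs.
    assert (e := inj (PI - arc_th a b t) (PI - arc_th a b u) ltac:(lra) ltac:(lra) hs). lra.
Qed.

(** * From the parameters to a steady state *)

(** The cosine of [theta1bar] and the sine of [theta3bar - PI + beta] are positive near
    [(A, sg) = (1, 0)]. *)
Lemma theta3bar_range (beta A sg : R) : PI / 2 < beta < PI -> near beta A sg -> 0 < sg ->
  0 < theta3bar A sg < PI / 2 /\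
  - (PI / 2) < theta1bar A sg beta < 0 /\
  0 < theta3bar A sg - PI + beta < PI / 2.
Proof.
intros hb hn hs. assert (hpi := PI_RGT_0).
destruct (near_bounds beta A sg hb hn) as [n1 [n2 [n3 [n4 [n5 n6]]]]].
destruct (beta_signs beta hb) as [hc _].
assert (hA := proj1 hn). assert (hr := rbar_pos A sg (proj1 hA)).
assert (h3 : 0 < theta3bar A sg < PI / 2).
{ rewrite theta3bar_atan by lra. assert (b := atan_bound (sg / A)).
  assert (0 < atan (sg / A)).
  { rewrite <- atan_0. apply atan_increasing, Rdiv_lt_0_compat; lra. }
  lra. }
split; [exact h3|]. split.
- assert (hcos : 0 < cos (theta1bar A sg beta)).
  { rewrite cos_theta1bar by lra. apply Rdiv_lt_0_compat; lra. }
  assert (h := angle_of_cos_pos (theta1bar A sg beta)).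
  unfold theta1bar in *. assert (g := h ltac:(lra) hcos). lra.
- split; [|lra].
  assert (hsin : 0 < sin (theta3bar A sg - PI + beta)).
  { replace (theta3bar A sg - PI + beta) with (- (PI - (theta3bar A sg + beta))) by ring.
    rewrite sin_neg, Rtrigo_facts.sin_pi_minus, sin_plus, sin_theta3bar, cos_theta3bar by lra.
    replace (- (A / rbar A sg * cos beta + sg / rbar A sg * sin beta))
      with (junction_lift beta A sg / rbar A sg) by (unfold junction_lift; field; lra).
    apply Rdiv_lt_0_compat; lra. }
  destruct (Rlt_le_dec 0 (theta3bar A sg - PI + beta)) as [l|l]; [exact l|exfalso].
  assert (0 <= sin (- (theta3bar A sg - PI + beta))) by (apply sin_ge_0; lra).
  rewrite sin_neg in H. lra.
Qed.

Lemma rbar_incr (A x y : R) : 0 < A -> 0 <= x < y -> rbar A x < rbar A y.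
Proof. intros hA h. unfold rbar. apply sqrt_lt_1; nra. Qed.

Lemma rbar_0 (A : R) : 0 < A -> rbar A 0 = A.
Proof.
intros h. unfold rbar. replace (0 ^ 2 + A ^ 2) with (A ^ 2) by ring.
apply sqrt_pow2; lra.
Qed.

(** Intersections are excluded by comparing radii, except between the drop and the catenoid:
    where the drop goes up its radius is below [a_ell < A], and where it goes down its height
    is above that of the junction. *)
Lemma steady_state_exists (beta A sg : R) : PI / 2 < beta < PI -> near beta A sg ->
  0 < sg -> 2 * sg ^ 2 < 1 - A ^ 2 -> closing beta A sg = 0 ->
  exists S, steady_state beta PI S /\ A_sigma S = (A, sg).
Proof.
intros hb hn hs hd2 hbal. assert (hpi := PI_RGT_0).
destruct (near_bounds beta A sg hb hn) as [n1 [n2 [n3 [n4 [n5 n6]]]]].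
destruct (beta_signs beta hb) as [hc [hsn hcs]].
assert (hA := proj1 hn).
assert (hd : 0 < outer_gap A sg) by (unfold outer_gap; nra).
assert (hbb : 0 < bend_radius beta A sg) by (apply Rdiv_lt_0_compat; lra).
assert (hbb2 := bend_radius_bounds beta A sg hb hn).
assert (hbb3 := eta_bounds beta hb).
assert (ha := sqrt_inner_radius2_bounds beta A sg hb hn).
assert (haa := inner_radius2_bounds beta A sg hb hn).
destruct (theta3bar_range beta A sg hb hn hs) as [o3 [o1 o2]].
assert (hr := rbar_pos A sg (proj1 hA)). assert (hr2 := rbar_sqr A sg).
assert (hbn : 2 * bend_radius beta A sg * junction_lift beta A sg = outer_gap A sg) by
  (unfold bend_radius; field; lra).
set (b := bend_radius beta A sg) in *. set (a := sqrt (inner_radius2 beta A sg)) in *.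
assert (ha2 : a ^ 2 = inner_radius2 beta A sg) by (apply pow2_sqrt; lra).
assert (hab : 0 < b < a) by lra. assert (hb1 : 0 < b < 1) by lra.
assert (hrb1 : rbar A sg < 1) by (unfold outer_gap in hd; nra).
assert (hAr : A < rbar A sg) by nra.
assert (haA : a < A).
{ assert (a ^ 2 < A ^ 2); [|nra]. rewrite ha2. unfold inner_radius2. fold b.
  assert (junction_lift beta A sg <= - (A * cos beta)) by (unfold junction_lift; nra).
  assert (outer_gap A sg <= 2 * b * - (A * cos beta)) by nra.
  unfold outer_gap in *. nra. }
destruct (arc_th_surj a b (theta1bar A sg beta) hab ltac:(lra)) as [t1 [ht1 e1]].
destruct (arc_th_surj 1 b (PI - (theta3bar A sg - PI + beta)) hb1 ltac:(lra)) as [t2 [ht2 e2]].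
(* both radii come from the first integral read at the junction, which is how
   [lam] and [a_ell] are obtained from [A], [sg] and [beta] *)
assert (er1 : arc_r a b t1 = rbar A sg).
{ apply arc_r_unique; auto. rewrite e1. unfold theta1bar.
  rewrite sin_minus, sin_theta3bar, cos_theta3bar by lra.
  transitivity (- 2 * b * (A * cos beta - sg * sin beta)); [|field; lra].
  rewrite ha2, hr2. unfold inner_radius2. fold b. unfold junction_lift, outer_gap in hbn. lra. }
assert (er2 : arc_r 1 b t2 = rbar A sg).
{ apply arc_r_unique; auto. rewrite e2, Rtrigo_facts.sin_pi_minus.
  replace (theta3bar A sg - PI + beta) with (- (PI - (theta3bar A sg + beta))) by ring.
  rewrite sin_neg, Rtrigo_facts.sin_pi_minus, sin_plus, sin_theta3bar, cos_theta3bar by lra.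
  transitivity (- 2 * b * junction_lift beta A sg); [|unfold junction_lift; field; lra].
  rewrite hr2. unfold outer_gap in hbn. lra. }
assert (ez1 : arc_z a b t1 = zbar A sg).
{ rewrite arc_height, e1 by exact hab.
  assert (z := z1_closing beta A sg hb hn hd). rewrite hbal in z.
  rewrite z1_height in z by (try assumption; lra). fold a b in z.
  apply Rmult_integral in z. destruct z; lra. }
assert (hzb : zbar A sg = A * arcsinh (sg / A)) by (apply zbar_arcsinh; lra).
assert (hasinh : forall x, 0 < x -> 0 < arcsinh x)
  by (intros x hx; rewrite <- arcsinh_0; now apply arcsinh_lt).
assert (hzb0 : 0 < zbar A sg).
{ rewrite hzb. apply Rmult_lt_0_compat; [lra|]. apply hasinh, Rdiv_lt_0_compat; lra. }
destruct (arc_curve a b t1 hab ht1 ltac:(lra)) as [G1 [g11 [g12 [g13 g14]]]].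
destruct (reversed_arc_curve 1 b t2 (zbar A sg + arc_z 1 b t2) hb1 ht2 ltac:(lra))
  as [G2 [g21 [g22 [g23 g24]]]].
destruct (catenary_curve A sg ltac:(lra) hs) as [G3 [g31 [g32 [g35 [g33 g34]]]]].
(* the outer arc lies outside the circle of radius [rbar], the catenary inside;
   the drop is inside too and, while it descends, stays above the junction *)
assert (p1 : forall x, I01 x -> x < 1 -> arc_r a b (t1 * x) < rbar A sg /\
   (arc_r a b (t1 * x) < A \/ zbar A sg < arc_z a b (t1 * x))).
{ intros x hx hx1. unfold I01 in hx. assert (hlt : t1 * x < t1) by nra.
  destruct (Rle_lt_dec 0 (arc_th a b (t1 * x))) as [l|l].
  - assert (h := arc_r_le a b (t1 * x) hab ltac:(nra) l). lra.
  - rewrite <- er1, <- ez1. split.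
    + apply arc_r_incr; auto; lra.
    + right. apply arc_z_decr; auto; lra. }
assert (z1pos : forall x, 0 < x <= 1 -> 0 < arc_z a b (t1 * x)).
{ intros x hx. destruct (Rle_lt_dec 0 (arc_th a b (t1 * x))) as [l|l].
  - rewrite <- (arc_z_0 a b). apply arc_z_incr; auto; nra.
  - destruct (Req_dec x 1) as [e|e]; [rewrite e, Rmult_1_r; lra|].
    assert (arc_z a b t1 < arc_z a b (t1 * x)) by (apply arc_z_decr; auto; nra || lra).
    lra. }
assert (p2 : forall x y, 0 <= x < y -> y <= 1 -> arc_r 1 b (t2 * (1 - x)) < arc_r 1 b (t2 *
  (1 - y))).
{ intros x y hxy hy. apply arc_r_decr; auto; [nra|].
  apply Rle_trans with (arc_th 1 b t2); [lra|]. apply arc_th_decr_le; auto; nra. }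
assert (z2 : forall x, I01 x -> arc_z 1 b (t2 * (1 - x)) <= arc_z 1 b t2).
{ intros x hx. unfold I01 in hx. destruct (Req_dec x 0) as [e|e].
  - rewrite e, Rminus_0_r, Rmult_1_r. lra.
  - left. apply arc_z_incr; auto; nra || lra. }
assert (p20 : forall x, 0 < x <= 1 -> rbar A sg < arc_r 1 b (t2 * (1 - x))).
{ intros x hx. assert (h := p2 0 x ltac:(lra) ltac:(lra)).
  rewrite Rminus_0_r, Rmult_1_r, er2 in h. exact h. }
assert (p21 : arc_r 1 b (t2 * (1 - 1)) = 1)
  by (rewrite Rminus_diag, Rmult_0_r; apply arc_r_0; lra).
assert (p3 : forall x y, 0 <= x < y -> rbar A (sg * x) < rbar A (sg * y))
  by (intros x y hxy; apply rbar_incr; [lra|nra]).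
assert (p30 : forall x, I01 x -> A <= rbar A (sg * x)).
{ intros x hx. unfold I01 in hx. destruct (Req_dec x 0) as [e|e].
  - rewrite e, Rmult_0_r, rbar_0; lra.
  - assert (h := p3 0 x ltac:(lra)). rewrite Rmult_0_r, rbar_0 in h; lra. }
assert (p31 : forall x, 0 <= x < 1 -> rbar A (sg * x) < rbar A sg).
{ intros x hx. assert (h := p3 x 1 ltac:(lra)). now rewrite Rmult_1_r in h. }
assert (z3 : forall x, I01 x -> A * arcsinh (sg * x / A) <= zbar A sg).
{ intros x hx. unfold I01 in hx. rewrite hzb. apply Rmult_le_compat_l; [lra|].
  apply arcsinh_le. unfold Rdiv. apply Rmult_le_compat_r; [|nra].
  apply Rlt_le, Rinv_0_lt_compat; lra. }
assert (g1e : forall x, cr G1 x = arc_r a b (t1 * x)) by apply g11.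
assert (g1z : forall x, cz G1 x = arc_z a b (t1 * x)) by apply g11.
assert (g2e : forall x, cr G2 x = arc_r 1 b (t2 * (1 - x))) by apply g21.
assert (g2z : forall x, cz G2 x = zbar A sg + arc_z 1 b t2 - arc_z 1 b (t2 * (1 - x))) by
  apply g21.
assert (g3e : forall x, cr G3 x = rbar A (sg * x)) by apply g31.
assert (g3z : forall x, cz G3 x = A * arcsinh (sg * x / A)) by apply g31.
exists (mkConfig G1 G2 G3). split; [|unfold A_sigma, r3star; simpl].
2: { rewrite g3e, Rmult_0_r, rbar_0, g35 by lra. reflexivity. }
assert (hj1 : at_point G1 1 (rbar A sg) (zbar A sg))
  by (split; [rewrite g1e|rewrite g1z]; now rewrite Rmult_1_r).
assert (hj2 : at_point G2 0 (rbar A sg) (zbar A sg)).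
{ split; [rewrite g2e|rewrite g2z]; rewrite Rminus_0_r, Rmult_1_r; [exact er2|lra]. }
assert (hj3 : at_point G3 1 (rbar A sg) (zbar A sg))
  by (split; [rewrite g3e|rewrite g3z]; rewrite Rmult_1_r; auto).
unfold steady_state; simpl.
split; [|split; [|split; [|split; [|split; [|split; [|split; [|split]]]]]]].
- intros x hx. rewrite g1e, g3e. assert (hq := arc_r_pos a b (t1 * x) hab).
  assert (h3 := p30 x hx). destruct (Req_dec x 1) as [e|e].
  + rewrite e, !Rmult_1_r, er1 in *. lra.
  + destruct (p1 x hx ltac:(lra)). assert (h31 := p31 x ltac:(lra)). lra.
- intros x hx. rewrite g2e. split; [now apply arc_r_pos|].
  assert (h := p2 x 1 hx ltac:(lra)). lra.
- intros x hx. rewrite g1z, g3z. split; [now apply z1pos|].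
  apply Rmult_lt_0_compat; [lra|]. apply hasinh, Rdiv_lt_0_compat; nra.
- intros x hx. rewrite g2z. assert (h := z2 x hx). lra.
- exists a, A, (zbar A sg + arc_z 1 b t2), (rbar A sg), (zbar A sg).
  split; [lra|]. split; [lra|]. split.
  { assert (h := z2 1 ltac:(unfold I01; lra)).
    rewrite Rminus_diag, Rmult_0_r, arc_z_0 in h. lra. }
  split; [lra|]. split; [exact hzb0|].
  split. { split; [rewrite g1e|rewrite g1z]; rewrite Rmult_0_r; [apply arc_r_0; lra|apply
    arc_z_0]. }
  split; [exact hj1|]. split; [exact hj2|].
  split. { split; [rewrite g2e; exact p21|rewrite g2z].
    rewrite Rminus_diag, Rmult_0_r, arc_z_0. ring. }
  split. { split; [rewrite g3e, Rmult_0_r; apply rbar_0; lra|rewrite g3z].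
    rewrite Rmult_0_r. replace (0 / A) with 0 by (unfold Rdiv; ring).
    rewrite arcsinh_0. ring. }
  split; [exact hj3|]. split; [|split].
  + intros x y hx hy er ez. rewrite g1e, g2e in er.
    destruct (Req_dec x 1) as [->|e]; [exact hj1|exfalso].
    destruct (p1 x hx) as [h _]; [unfold I01 in hx; lra|].
    destruct (Req_dec y 0) as [k|k].
    * rewrite k, Rminus_0_r, Rmult_1_r in er. lra.
    * assert (h' := p20 y). unfold I01 in hy. specialize (h' ltac:(lra)). lra.
  + intros x y hx hy er ez. rewrite g1e, g3e in er. rewrite g1z, g3z in ez.
    destruct (Req_dec x 1) as [->|e]; [exact hj1|exfalso].
    destruct (p1 x hx) as [_ h]; [unfold I01 in hx; lra|].
    assert (h1 := p30 y hy). assert (h2 := z3 y hy). lra.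
  + intros x y hx hy er ez. rewrite g2e, g3e in er.
    destruct (Req_dec x 0) as [->|e]; [exact hj2|exfalso]. unfold I01 in *.
    assert (h := p20 x ltac:(lra)). destruct (Req_dec y 1) as [k|k].
    * rewrite k, Rmult_1_r in er. lra.
    * assert (h' := p31 y ltac:(lra)). lra.
- auto.
- exists (- (1 / (2 * b))). intros x hx. auto.
- exists (fun x => arc_th a b (t1 * x)), (fun x => PI - arc_th 1 b (t2 * (1 - x))),
    (fun x => PI / 2 - atan (sg * x / A)).
  split; [exact g13|]. split; [exact g23|]. split; [exact g33|].
  rewrite !Rmult_0_r, !Rmult_1_r, Rminus_0_r, Rminus_diag, Rmult_0_r, Rmult_1_r.
  rewrite !arc_th_0, e1, e2.
  replace (0 / A) with 0 by (unfold Rdiv; ring). rewrite atan_0.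
  unfold theta1bar. rewrite theta3bar_atan by lra. repeat split; lra.
- split; [|split].
  + intros x y hx hy er ez. rewrite !g1e in er. rewrite !g1z in ez. unfold I01 in *.
    destruct (Rtotal_order x y) as [l|[l|l]]; [exfalso|exact l|exfalso].
    * apply (arc_no_crossing a b t1 (t1 * x) (t1 * y)); auto; nra || lra.
    * apply (arc_no_crossing a b t1 (t1 * y) (t1 * x)); auto; nra || lra.
  + intros x y hx hy er _. rewrite !g2e in er. unfold I01 in *.
    destruct (Rtotal_order x y) as [l|[l|l]]; [exfalso|exact l|exfalso].
    * assert (h := p2 x y ltac:(lra) ltac:(lra)). lra.
    * assert (h := p2 y x ltac:(lra) ltac:(lra)). lra.
  + intros x y hx hy er _. rewrite !g3e in er. unfold I01 in *.
    destruct (Rtotal_order x y) as [l|[l|l]]; [exfalso|exact l|exfalso].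
    * assert (h := p3 x y ltac:(lra)). lra.
    * assert (h := p3 y x ltac:(lra)). lra.
Qed.

(** * The theorem *)

(** The first and the last constraint hold because [sg] is small, the second because its
    premise fails, and the third with equality, by the closing condition. *)
Lemma admissibility_constraints (beta A sg : R) : PI / 2 < beta < PI ->
  near beta A sg -> 0 < sg -> 2 * sg ^ 2 < 1 - A ^ 2 -> closing beta A sg = 0 ->
  tan beta > A / sg * (1 - 2 * A ^ 2 - 2 * sg ^ 2) /\
  (cos beta < - (A / sqrt (sg ^ 2 + A ^ 2)) -> cos beta < - (1 / (2 * A))) /\
  z1 A sg beta PI <= 0 /\
  tan beta < A * (1 - A ^ 2 - 2 * sg ^ 2) / (sg * (1 - A ^ 2)).
Proof.
intros hb hn hs hd2 hbal.
destruct (near_bounds beta A sg hb hn) as [n1 [n2 [n3 [n4 [n5 n6]]]]].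
destruct (beta_signs beta hb) as [hc [hsn hcs]].
destruct (eta_bounds beta hb) as [e0 [e1 e2]].
assert (hA := proj1 hn).
assert (hd : 0 < outer_gap A sg) by (unfold outer_gap; nra).
assert (htan : tan beta < 0).
{ unfold tan, Rdiv. assert (h := Rinv_lt_0_compat _ (proj2 hc)). nra. }
split; [|split; [|split]].
- apply Rlt_gt. apply Rlt_le_trans with (- (1 / sg * (1 / 2))).
  + apply Rmult_lt_reg_r with (2 * sg); [lra|].
    replace (A / sg * (1 - 2 * A ^ 2 - 2 * sg ^ 2) * (2 * sg))
      with (2 * A * (1 - 2 * A ^ 2 - 2 * sg ^ 2)) by (field; lra).
    replace (- (1 / sg * (1 / 2)) * (2 * sg)) with (-1) by (field; lra). nra.
  (* [sg] is much smaller than [- cos beta], while [sin beta < 1] *)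
  + unfold tan. apply Rmult_le_reg_r with (2 * sg * - cos beta); [nra|].
    replace (- (1 / sg * (1 / 2)) * (2 * sg * - cos beta)) with (cos beta) by (field; lra).
    replace (sin beta / cos beta * (2 * sg * - cos beta)) with (- (2 * sg * sin beta))
      by (field; lra). nra.
- intros h. exfalso. fold (rbar A sg) in h.
  assert (hr := rbar_pos A sg (proj1 hA)). assert (hr2 := rbar_sqr A sg).
  assert (hr1 : rbar A sg < 1) by (unfold outer_gap in hd; nra).
  assert (hq : A < A / rbar A sg).
  { apply Rmult_lt_reg_r with (rbar A sg); [lra|].
    unfold Rdiv. rewrite Rmult_assoc, Rinv_l by lra. nra. }
  destruct hn as [_ [_ [_ hA2]]].
  assert (eta beta ^ 2 <= sin beta ^ 2 / 10000) by nra.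
  assert (cos beta ^ 2 < A ^ 2) by nra. nra.
- assert (z := z1_closing beta A sg hb hn hd). rewrite hbal in z.
  apply Rmult_integral in z. destruct z; lra.
- apply Rlt_trans with (1 := htan). apply Rdiv_lt_0_compat; nra.
Qed.

Theorem theorem6p1 (beta : R) (hbeta : PI / 2 < beta < PI) :
  exists (eps : R) (sigma : R -> R),
    0 < eps < 1 /\
    (forall A, 1 - eps < A < 1 -> continuous sigma A /\ Omega0 A (sigma A)) /\
    bijective_mod same_config A_sigma
      (fun S => steady_state beta PI S /\ 1 - eps < r3star S < 1)
      (fun p => 1 - eps < fst p < 1 /\ snd p = sigma (fst p)) /\
    (forall A, 1 - eps < A < 1 ->
       tan beta > A / sigma A * (1 - 2 * A ^ 2 - 2 * sigma A ^ 2) /\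
       (cos beta < - (A / sqrt (sigma A ^ 2 + A ^ 2)) ->
          cos beta < - (1 / (2 * A))) /\
       z1 A (sigma A) beta PI <= 0 /\
       tan beta < A * (1 - A ^ 2 - 2 * sigma A ^ 2) / (sigma A * (1 - A ^ 2))) /\
    filterlim sigma (at_left 1) (locally 0).
Proof.
destruct (root_function beta hbeta) as [sigma hsig].
exists (eta beta ^ 2 / 2), sigma.
change (fun p : R * R => 1 - eta beta ^ 2 / 2 < fst p < 1 /\ snd p = sigma (fst p))
  with (fun p : R * R => range_A beta (fst p) /\ snd p = sigma (fst p)).
change (fun S => steady_state beta PI S /\ 1 - eta beta ^ 2 / 2 < r3star S < 1)
  with (fun S => steady_state beta PI S /\ range_A beta (r3star S)).
destruct (eta_bounds beta hbeta) as [e0 [e1 e2]].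
destruct (beta_signs beta hbeta) as [hc [hsn _]].
assert (hnear : forall A, range_A beta A -> near beta A (sigma A)).
{ intros A hA. destruct (hsig A hA) as [s1 [s2 _]].
  apply near_of_range; auto; nra. }
assert (hsteady : forall S, steady_state beta PI S -> range_A beta (r3star S) ->
  arclength (Gam3 S) = sigma (r3star S)).
{ intros S hS hA. destruct (steady_state_explicit beta S hbeta hS hA) as [h1 [h2 _]].
  apply (closing_root_unique beta (r3star S)); auto. apply hsig, hA. }
split; [nra|]. split; [|split; [|split]].
- intros A hA. split; [now apply (root_continuous beta)|].
  destruct (hsig A hA) as [s1 [s2 _]].
  split; [apply (range_A_bounds beta A hbeta hA)|]. split; [exact s1|].
  rewrite <- (sqrt_pow2 (sigma A)) by lra. apply sqrt_lt_1; nra.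
- split; [|split].
  + intros S [hS hA]. split; [exact hA|]. now apply hsteady.
  + intros S S' [hS hA] [hS' hA']. split.
    * intros e. unfold A_sigma. rewrite !hsteady by assumption.
      assert (e' : r3star S = r3star S')
        by (apply (proj2 (proj2 e) 0); unfold I01; lra).
      now rewrite e'.
    * intros e. apply pair_equal_spec in e. destruct e as [eA es].
      destruct (steady_state_explicit beta S hbeta hS hA) as [_ [_ [t1 [t2 E]]]].
      destruct (steady_state_explicit beta S' hbeta hS' hA') as [_ [_ [u1 [u2 E']]]].
      rewrite <- eA, <- es in E'. rewrite hsteady in E, E' by assumption.
      apply (explicit_config_unique beta (r3star S) (sigma (r3star S)) t1 t2 u1 u2); auto.
      destruct (hsig _ hA) as [s1 [s2 _]]. unfold outer_gap. nra.
  + intros [A sg] [hA e]. simpl in hA, e. subst sg.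
    destruct (hsig A hA) as [s1 [s2 s3]].
    destruct (steady_state_exists beta A (sigma A)) as [S [hS eS]]; auto.
    exists S. split; [|exact eS]. split; [exact hS|].
    unfold A_sigma in eS. injection eS. intros _ ->. exact hA.
- intros A hA. destruct (hsig A hA) as [s1 [s2 s3]].
  apply admissibility_constraints; auto.
- apply (root_limit beta sigma hbeta). intros A hA.
  destruct (hsig A hA) as [s1 [s2 _]]. auto.
Qed.
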